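(* There exists a one-parameter group of transformations $\Phi_t : \mathcal{X}_0 \to \mathcal{X}_0$, $t\in \mathbb{R}$, such that $t \mapsto \Phi_t(x)$ is the unique global solution to the system of equations of motion $$\dot q_i (t) = p_i(t), \qquad \dot p_i(t) = F_i(x(t)), \qquad i \in \mathbb{Z}^d,$$ with initial condition $\Phi_0(x)=x$. Moreover $\Phi_t(x)_j = x_j(t) = (q_j(t),p_j(t))$ are differentiable functions with respect to $x_i = (q_i,p_i)$ for any $j,i\in\mathbb{Z}^d$ and $t\in\mathbb{R}$. Finally, there exists a constant $C_0$ such that $$Q(\Phi_t(x)) \leqslant C_0 \Big\{ Q(x) \log [e+Q(x)] + t^4 \Big\}.$$
   Context: At each site $i$ of the lattice $\mathbb{Z}^d$ there is an oscillator with coordinate $q_i\in\mathbb{R}$ and momentum $p_i\in\mathbb{R}$; a state is $x=\{x_i\}_{i\in\mathbb{Z}^d}=\{(q_i,p_i)\}_{i\in\mathbb{Z}^d}$, and $\mathcal{X}$ denotes the set of all such states with the product topology. The force on the $i$-th oscillator is $F_i(x) = - U'(q_i) - K \sum_{j:|j-i|=1} (q_i-q_j)$, with $K>0$ and $U$ a non negative polynomial of degree $4$ with strictly positive leading coefficient, where $|i-j|=\sum_{\ell=1}^d |i_\ell-j_\ell|$. For $\nu\in\mathbb{Z}^d$ and $k\in\mathbb{N}$, let $\Lambda_{\nu,k}$ be the cube of center $\nu$ and side $2k+1$ and $$W_{\nu,k}(x) = \sum_{i\in\Lambda_{\nu,k}} \Big\{ \tfrac{p_i^2}{2} + U(q_i)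 + 1 \Big\} + \sum_{i,j\in\Lambda_{\nu,k},\,|j-i|=1} \tfrac K4 (q_i-q_j)^2,$$ $$Q(x) = \sup_{\nu\in\mathbb{Z}^d} \,\sup_{k>\log^{1/d}(e+|\nu|)} \frac{W_{\nu,k}(x)}{(2k+1)^d},$$ and $\mathcal{X}_0 = \{ x\in \mathcal{X} : Q(x)<\infty\}$. *)

(* Defs.v *)
From HB Require Import structures.
From mathcomp Require Import all_boot all_order all_algebra.
From mathcomp Require Import all_classical all_reals all_analysis.
Set Implicit Arguments. Unset Strict Implicit. Unset Printing Implicit Defensive.
Import Order.TTheory GRing.Theory Num.Theory.
Import numFieldNormedType.Exports.
Local Open Scope classical_set_scope.
Local Open Scope ring_scope.

Definition site (d : nat) := {ffun 'I_d -> int}.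

Definition ldist (d : nat) (i j : site d) : nat := (\sum_(l < d) absz (i l - j l))%N.
Definition lnorm (d : nat) (i : site d) : nat := (\sum_(l < d) absz (i l))%N.

(* A state: x_i = (q_i, p_i) for every site i *)
Definition state (R : realType) (d : nat) := site d -> R * R.

(* points of the cube Lambda_{nu,k} (center nu, side 2k+1), enumerated
   bijectively by offsets o : 'I_d -> 'I_(2k+1) *)
Definition cube_pt (d : nat) (nu : site d) (k : nat) (o : {ffun 'I_d -> 'I_(k.*2.+1)}) : site d :=
  [ffun l => nu l + (o l)%:Z - k%:Z].

Arguments cube_pt {d} nu k o.

(* force F_i(x) = -U'(q_i) - K sum_{|j-i|=1} (q_i - q_j);
   the neighbours of i all lie in the cube Lambda_{i,1} *)
Definition force (R : realType) (d : nat) (U : {poly R}) (K : R) (x : state R d) (i : site d) : R :=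
  - (U^`()).[(x i).1]
  - K * \sum_(o : {ffun 'I_d -> 'I_(1%N.*2.+1)})
          (if ldist (cube_pt i 1%N o) i == 1%N then (x i).1 - (x (cube_pt i 1%N o)).1 else 0).

Definition Wloc (R : realType) (d : nat) (U : {poly R}) (K : R) (nu : site d) (k : nat) (x : state R d) : R :=
  \sum_(o : {ffun 'I_d -> 'I_(k.*2.+1)})
     ((x (cube_pt nu k o)).2 ^+ 2 / 2 + U.[(x (cube_pt nu k o)).1] + 1)
  + \sum_(o1 : {ffun 'I_d -> 'I_(k.*2.+1)}) \sum_(o2 : {ffun 'I_d -> 'I_(k.*2.+1)})
      (if ldist (cube_pt nu k o2) (cube_pt nu k o1) == 1%N then
         K / 4 * ((x (cube_pt nu k o1)).1 - (x (cube_pt nu k o2)).1) ^+ 2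
       else 0).

Definition Qfun (R : realType) (d : nat) (U : {poly R}) (K : R) (x : state R d) : \bar R :=
  ereal_sup [set e : \bar R | exists (nu : site d) (k : nat),
      powR (ln (expR 1 + (lnorm nu)%:R)) (d%:R)^-1 < (k%:R : R) /\
      e = (Wloc U K nu k x / (k.*2.+1)%:R ^+ d)%:E].

Definition X0 (R : realType) (d : nat) (U : {poly R}) (K : R) : set (state R d) :=
  [set x | (Qfun U K x < +oo)%E].

Definition solves (R : realType) (d : nat) (U : {poly R}) (K : R) (y : R -> state R d) : Prop :=
  forall (i : site d) (t : R),
    is_derive t 1 (fun s => (y s i).1) (y t i).2 /\
    is_derive t 1 (fun s => (y s i).2) (force U K (y t) i).

Definition upd (R : realType) (d : nat) (x : state R d) (i : site d) (w : R * R) : state R d :=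
  fun j => if j == i then w else x j.

(* Main.v *)
Require Import Defs.
From HB Require Import structures.
From mathcomp Require Import all_boot all_order all_algebra.
From mathcomp Require Import all_classical all_reals all_analysis.
From mathcomp Require Import ring lra zify.
Import Order.TTheory GRing.Theory Num.Theory.
Import numFieldNormedType.Exports.
Local Open Scope classical_set_scope.
Local Open Scope ring_scope.

Set Implicit Arguments.
Unset Strict Implicit.
Unset Printing Implicit Defensive.

(* Let [h_i = p_i^2/2 + V_i(q_i) + 1]. Only the coupling changes [h_i] in time, and since
   the coupling is harmonic while [V_i] is quartic, for every [lam > 0]
   [|dh_i/dt| <= (C/lam) sum_(|j - i|_oo <= 1) (h_j + lam^4)]. Averaging over the
   cubes [Lambda_(nu,k)], the mean of [h + lam^4] over [Lambda_(nu,k)] has a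
   derivative at most [C/lam] times its mean over [Lambda_(nu,k+1)], so a
   Gronwall iteration in k gives [N(t) + lam^4 <= e^(C|t|/lam) (N(0) + lam^4)] for
   the supremum N of the means over admissible cubes. Taking [lam = |t|] yields
   [Q(t) <= C_0 (Q + t^4)], which is stronger than the stated bound.
   Finiteness of Q gives [h_i = O(log (e + |i|))], hence a force with Lipschitz
   constant [O(log (e + |i|))] at site i. Such systems are well posed in the
   sup-norm weighted by [exp ((a + c|t|) log (a + e + |i| + c|t|))], on which the
   Picard map is a contraction by 1/2. Existence follows by clipping [U']
   at height [sqrt (rho log (e + |i|))]: the energy bound is uniform in rho, so for rho
   large the clip is never reached on a given time interval. Uniqueness among
   solutions that are only pointwise in time in [X_0] needs a Baire-type argument
   to make Q locally bounded first. For differentiability, the difference of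
   two solutions minus the solution of the linearised equation is quadratically
   small in the square of the weight. *)

(** * Comparison by derivatives and antiderivatives *)

(** The Gronwall iteration keeps the centre nu fixed and only enlarges k, so it never leaves the
    admissible cubes; this is why it closes on a supremum with a logarithmic threshold. The
    hierarchy in k is infinite, and the argument needs some bound B e^(Dk) beforehand, whose
    constants then disappear from the result. For the clipped dynamics it comes from the weight,
    which grows more slowly than e^|i|; for an arbitrary solution in X_0 it is what the Baire
    argument supplies. All derivative bounds are two-sided, so the estimates also run backwards in
    time, and the Baire argument uses both directions. The natural weight exp (c t log (e + |i|))
    gains a logarithm when differentiated in t, but near the origin its ratio between neighbouring
    sites grows exponentially in t. Adding a + c t inside the logarithm caps this ratio at e for all
    times, so the Picard iteration runs on the whole time axis at once. *)

Section PointwiseDerivatives.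
Variables (R : realType) (t : R).
Implicit Types (f g : R -> R) (a b c : R).

Lemma pder_eq f a b : is_derive t 1 f a -> a = b -> is_derive t 1 f b.
Proof. by move=> ? <-. Qed.

Lemma pderC c : is_derive t 1 (fun _ : R => c) 0.
Proof. exact: is_derive_cst. Qed.

Lemma pder_id : is_derive t 1 (fun s : R => s) 1.
Proof. exact: is_derive_id. Qed.

Lemma pderD f g a b : is_derive t 1 f a -> is_derive t 1 g b ->
  is_derive t 1 (fun s => f s + g s) (a + b).
Proof. by move=> ? ?; exact: is_deriveD. Qed.

Lemma pderB f g a b : is_derive t 1 f a -> is_derive t 1 g b ->
  is_derive t 1 (fun s => f s - g s) (a - b).
Proof. by move=> ? ?; exact: is_deriveB. Qed.

Lemma pderM f g a b : is_derive t 1 f a -> is_derive t 1 g b ->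
  is_derive t 1 (fun s => f s * g s) (f t * b + g t * a).
Proof. by move=> ? ?; exact: is_deriveM. Qed.

Lemma pderZ c f a : is_derive t 1 f a -> is_derive t 1 (fun s => c * f s) (c * a).
Proof. by move=> ?; exact: is_deriveZ. Qed.

Lemma pder_comp f g a b : is_derive (g t) 1 f a -> is_derive t 1 g b ->
  is_derive t 1 (fun s => f (g s)) (a * b).
Proof. by move=> ? ?; exact: is_derive1_comp. Qed.

Lemma pder_sum (I : finType) (f : I -> R -> R) (a : I -> R) :
  (forall i, is_derive t 1 (f i) (a i)) ->
  is_derive t 1 (fun s => \sum_i f i s) (\sum_i a i).
Proof.
move=> fa; elim: (index_enum I) => [|i r IH].
  rewrite big_nil (_ : (fun s => _) = (fun _ => 0)); first exact: pderC.
  by apply/funext => s; rewrite big_nil.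
rewrite big_cons (_ : (fun s => _) = (fun s => f i s + \sum_(i <- r) f i s)).
  exact: pderD.
by apply/funext => s; rewrite big_cons.
Qed.

End PointwiseDerivatives.

Lemma is_derive_cont (R : realType) (f : R -> R) (t df : R) :
  is_derive t 1 f df -> {for t, continuous f}.
Proof.
move=> h; apply: differentiable_continuous; rewrite -derivable1_diffP.
by case: h.
Qed.

Lemma deriv_ge0_le (R : realType) (f df : R -> R) (a b : R) : a <= b ->
  (forall s : R, a <= s <= b -> is_derive s 1 f (df s)) ->
  (forall s : R, a <= s <= b -> 0 <= df s) -> f a <= f b.
Proof.
move=> ab fd df0; rewrite -subr_ge0.
have [||c cab ->] := @MVT_segment R f df a b ab.
- move=> x; rewrite in_itv /= => /andP[/ltW ax /ltW xb].
  by apply: fd; rewrite ax xb.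
- apply: derivable_within_continuous => x; rewrite in_itv /= => xab.
  by case: (fd _ xab).
apply: mulr_ge0; last by rewrite subr_ge0.
by apply: df0; move: cab; rewrite in_itv.
Qed.

Lemma deriv_dom_le (R : realType) (z dz g dg : R -> R) (a b : R) : a <= b ->
  (forall s : R, a <= s <= b -> is_derive s 1 z (dz s)) ->
  (forall s : R, a <= s <= b -> is_derive s 1 g (dg s)) ->
  (forall s : R, a <= s <= b -> `|dz s| <= dg s) ->
  `|z a| <= g a -> `|z b| <= g b.
Proof.
move=> ab zd gd zg; rewrite !ler_norml => /andP[h1 h2].
have H1 : (g - z) a <= (g - z) b.
  apply: (@deriv_ge0_le R _ (fun s => dg s - dz s)) => // s sab.
    by have := gd _ sab; have := zd _ sab; move=> ? ?; apply: is_deriveB.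
  by rewrite subr_ge0 (le_trans (ler_norm _)) // zg.
have H2 : (g + z) a <= (g + z) b.
  apply: (@deriv_ge0_le R _ (fun s => dg s + dz s)) => // s sab.
    by have := gd _ sab; have := zd _ sab; move=> ? ?; apply: is_deriveD.
  by have := zg _ sab; rewrite ler_norml => /andP[]; lra.
rewrite /= !fctE in H1 H2.
by apply/andP; split; lra.
Qed.

Lemma is_derive_aff (R : realType) (f : R -> R) (a e t df : R) :
  is_derive (a + e * t) 1 f df -> is_derive t 1 (fun s => f (a + e * s)) (e * df).
Proof.
move=> fd; rewrite mulrC.
apply: (@pder_comp _ _ f (fun s => a + e * s)) => //.
have := pderD (pderC t a) (pderZ e (pder_id t)).
by rewrite add0r mulr1.
Qed.

(** Weights depend on elapsed time only, so negative times are reflected onto positive ones. This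
    comparison replaces the integration of norms in the later estimates. *)
Lemma deriv_dom_le_sym (R : realType) (T : R) (z dz g dg : R -> R) :
  (forall s : R, `|s| <= T -> is_derive s 1 z (dz s)) ->
  (forall s : R, 0 <= s -> is_derive s 1 g (dg s)) ->
  (forall s : R, `|s| <= T -> `|dz s| <= dg `|s|) ->
  `|z 0| <= g 0 -> forall t : R, `|t| <= T -> `|z t| <= g `|t|.
Proof.
move=> zd gd zg z0 t tT.
case: (leP 0 t) => t0.
  rewrite (ger0_norm t0) in tT *.
  have P s : 0 <= s <= t -> `|s| <= T by case/andP => s0 st; rewrite ger0_norm //; lra.
  apply: (@deriv_dom_le R z dz g dg 0 t) => // s sab.
  - exact/zd/P.
  - by apply: gd; case/andP: sab.
  - by have := zg s (P _ sab); rewrite (ger0_norm (_ : 0 <= s)) //; case/andP: sab.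
rewrite (ltr0_norm t0) in tT *.
have P s : 0 <= s <= - t -> `|0 + -1 * s| <= T.
  by case/andP => s0 st; rewrite add0r mulN1r normrN ger0_norm //; lra.
have := @deriv_dom_le R (fun s => z (0 + -1 * s)) (fun s => -1 * dz (0 + -1 * s)) g dg 0 (- t).
rewrite mulr0 addr0 mulN1r opprK add0r; apply => //; first by lra.
- by move=> s sab; apply: is_derive_aff; apply/zd/P.
- by move=> s sab; apply: gd; case/andP: sab.
- move=> s sab; rewrite mulN1r normrN; have := zg _ (P _ sab).
  by rewrite add0r mulN1r normrN (ger0_norm (_ : 0 <= s)) //; case/andP: sab.
Qed.

(* A function vanishing on the negative half-line is integrable on
   ]-oo, x], so the fundamental theorem applies with no left endpoint. *)
Lemma antiderivative_pos (R : realType) (g : R -> R) :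
  continuous g -> (forall s : R, s <= 0 -> g s = 0) ->
  exists G : R -> R, forall t : R, is_derive t 1 G (g t).
Proof.
move=> gc g0.
pose mu := @lebesgue_measure R.
have gi u : mu.-integrable `]-oo, u] (EFin \o g).
  apply/integrable_mkcond => //.
  rewrite (_ : _ \_ _ = (EFin \o g) \_ `[0, u]).
    apply: (iffLR (integrable_mkcond _ _)) => //.
    apply: (@continuous_compact_integrable R g); first exact: segment_compact.
    exact: continuous_subspaceT.
  apply/funext => s; rewrite !patchE.
  have [s0|s0] := leP 0 s.
    congr (if _ then _ else _).
    by apply/idP/idP; rewrite !inE /= !in_itv /= s0.
  by rewrite /= g0 ?(ltW s0) //; do !case: ifP.
exists (fun x => \int[mu]_(t in [set` `]-oo, x]]) g t).
move=> t.
have t1 : t < t + 1 by rewrite ltrDl.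
have [d1 d2] := @continuous_FTC1 R g -oo%O t (t + 1) t1 (gi _) (ltNyr _) (gc t).
by split; [exact: d1|rewrite -derive1E; exact: d2].
Qed.

Lemma antiderivative (R : realType) (g : R -> R) : continuous g ->
  exists G : R -> R, (forall t : R, is_derive t 1 G (g t)) /\ G 0 = 0.
Proof.
move=> gc.
have [|s s0|G1 h1] := @antiderivative_pos R (fun s => g (Num.max s 0) - g 0).
- move=> t; apply: cvgB; last exact: cvg_cst.
  apply: (@continuous_comp _ _ _ (fun s : R => Num.max s 0) g); last exact: gc.
  by apply: continuous_max; [exact: cvg_id|exact: cvg_cst].
- by rewrite max_r // subrr.
have [|s s0|G2 h2] := @antiderivative_pos R (fun s => g (- Num.max s 0) - g 0).
- move=> t; apply: cvgB; last exact: cvg_cst.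
  apply: (@continuous_comp _ _ _ (fun s : R => - Num.max s 0) g); last exact: gc.
  by apply: cvgN; apply: continuous_max; [exact: cvg_id|exact: cvg_cst].
- by rewrite max_r // oppr0 subrr.
(* [G1] carries the right half-line and the reflected [G2] the left one. Both integrands had [g 0]
   subtracted so as to vanish on the wrong side; the linear term restores it. *)
pose G x := G1 x - G2 (0 + -1 * x) + g 0 * x.
have Gd (t : R) : is_derive t 1 G (g t).
  have d1 := h1 t; have d2 := is_derive_aff (h2 (0 + -1 * t)).
  apply: (pder_eq (pderD (pderB d1 d2) (pderZ _ (pder_id _)))).
  rewrite /= mulr1 add0r !mulN1r.
  have [t0|t0] := leP 0 t.
    by rewrite (_ : Num.max (- t) 0 = 0) ?oppr0; [ring|rewrite max_r //; lra].
  rewrite (_ : Num.max (- t) 0 = - t); last by rewrite max_l //; lra.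
  by rewrite !opprK; ring.
exists (fun x => G x - G 0); split; last by rewrite subrr.
move=> t; apply: (pder_eq (pderB (Gd t) (pderC _ _))).
by rewrite subr0.
Qed.

(** * Picard iteration in weighted spaces *)

(** This replaces a passage to the limit: a contraction by 1/2 applied n times leaves an error b /
    2^n, beaten by the Archimedean property. *)
Lemma halving_le (R : realType) (x c b : R) :
  (forall n, x <= c + b / 2 ^+ n) -> x <= c.
Proof.
move=> h; rewrite leNgt; apply/negP => cx.
have [b0|b0] := leP b 0.
  by have := h 0%N; rewrite expr0 divr1; lra.
have xc : 0 < x - c by lra.
have := upper_nthrootP (leqnn (Num.bound (b / (x - c)))).
set n := Num.bound _ => hn; have := h n.
have p2 : 0 < 2 ^+ n :> R by rewrite exprn_gt0.
have : b / 2 ^+ n < x - c by rewrite ltr_pdivrMr // mulrC -ltr_pdivrMr.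
lra.
Qed.

Lemma nested_intervals (R : realType) (a b : nat -> R) :
  (forall n, a n <= a n.+1) -> (forall n, b n.+1 <= b n) ->
  (forall n, a n <= b n) -> exists t, forall n, a n <= t <= b n.
Proof.
move=> ai bd ab.
have amono : {homo a : m n / (m <= n)%N >-> m <= n} by apply: homo_leq => //; exact: le_trans.
have bmono : {homo b : m n / (m <= n)%N >-> n <= m}.
  by apply: (@homo_leq _ b (fun x y => y <= x)) => // x y z xy yz; exact: le_trans yz xy.
have amb m n : a m <= b n.
  apply: (le_trans (amono _ _ (leq_maxl m n))).
  exact: (le_trans (ab _) (bmono _ _ (leq_maxr m n))).
have ub n : ubound (range a) (b n) by move=> _ [m _ <-].
exists (sup (range a)) => n; apply/andP; split.
  by apply: ub_le_sup; [exists (b 0%N); exact: ub|exists n].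
by apply: ge_sup; [exists (a 0%N); exists 0%N|exact: ub].
Qed.

(** The intervals of radius 2c / 2^n about [u n] are nested, because a step of size c / 2^n is
    exactly the loss of radius. A common point is the limit, with its rate. *)
Lemma geometric_limit (R : realType) (u : nat -> R) (c : R) : 0 <= c ->
  (forall n, `|u n.+1 - u n| <= c / 2 ^+ n) ->
  exists l, forall n, `|u n - l| <= 2 * c / 2 ^+ n.
Proof.
move=> c0 uc.
have half n : 2 * c / 2 ^+ n.+1 = c / 2 ^+ n.
  by rewrite exprS; field; rewrite expf_neq0.
have p n : 0 <= c / 2 ^+ n by rewrite divr_ge0 // exprn_ge0.
have dbl n : 2 * c / 2 ^+ n = c / 2 ^+ n + c / 2 ^+ n by ring.
have [|||l lP] := @nested_intervals R (fun n => u n - 2 * c / 2 ^+ n)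
                     (fun n => u n + 2 * c / 2 ^+ n).
- by move=> n; rewrite half dbl; have := uc n; rewrite ler_norml => /andP[]; lra.
- by move=> n; rewrite half dbl; have := uc n; rewrite ler_norml => /andP[]; lra.
- by move=> n; rewrite dbl; have := p n; lra.
by exists l => n; rewrite ler_norml; have /andP[] := lP n; lra.
Qed.

(** Convergence is uniform only on bounded times, since [w] may grow. Monotonicity of [w] lets its
    value at |t| + 1 serve on the whole unit neighbourhood of t. *)
Lemma continuous_unif_limit (R : realType) (u : nat -> R -> R) (v w : R -> R) (c : R) :
  0 <= c ->
  (forall n, continuous (u n)) ->
  (forall s t : R, 0 <= s <= t -> w s <= w t) ->
  (forall n t, `|u n t - v t| <= c * w `|t| / 2 ^+ n) -> continuous v.
Proof.
move=> c0 uc wm uv t; apply/cvgrPdist_le => e e0.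
pose W := `|c * w (`|t| + 1)| + 1.
have W0 : 0 < W by rewrite /W ltr_wpDl.
have [n hn] : exists n, W / 2 ^+ n < e / 3.
  exists (Num.bound (W / (e / 3))).
  have := upper_nthrootP (leqnn (Num.bound (W / (e / 3)))).
  set n := Num.bound _ => hn.
  have e3 : 0 < e / 3 by lra.
  by rewrite ltr_pdivrMr ?exprn_gt0 // mulrC -ltr_pdivrMr.
have near_bd s : `|s| <= `|t| + 1 -> `|u n s - v s| <= e / 3.
  move=> st; apply: (le_trans (uv n s)); apply/ltW/(le_lt_trans _ hn).
  rewrite ler_pM2r ?invr_gt0 ?exprn_gt0 //.
  have : c * w `|s| <= c * w (`|t| + 1) by apply: ler_wpM2l => //; apply: wm; rewrite normr_ge0.
  by have := ler_norm (c * w (`|t| + 1)); rewrite /W; lra.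
have e3 : 0 < e / 3 by lra.
have /cvgrPdist_le /(_ _ e3) h1 := uc n t.
near=> s.
have s1 : `|t - s| <= 1.
  by near: s; apply: cvgr_dist_le; [exact: cvg_id|].
have A1 := near_bd t _.
have A2 : `|u n s - v s| <= e / 3.
  apply: near_bd; rewrite -[s](subKr t) (le_trans (ler_normB _ _)) //; lra.
have A3 : `|u n t - u n s| <= e / 3 by near: s; exact: h1.
have {A1} := A1 _; move/(_ _)=> A1.
have A1' : `|u n t - v t| <= e / 3 by apply: near_bd; lra.
move: A1' A2 A3; rewrite !ler_norml => /andP[? ?] /andP[? ?] /andP[? ?].
by apply/andP; split; lra.
Unshelve. all: by end_near. Qed.

Section Picard.
Variables (R : realType) (J : Type) (f : R -> (J -> R) -> J -> R) (x0 : J -> R).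
Variables (w dw : J -> R -> R) (B : R).
Hypothesis B0 : 0 <= B.
Hypothesis w_der : forall j (t : R), 0 <= t -> is_derive t 1 (w j) (dw j t).
Hypothesis w_ge0 : forall j (t : R), 0 <= t -> 0 <= w j t.
Hypothesis dw_ge0 : forall j (t : R), 0 <= t -> 0 <= dw j t.
Hypothesis f_cont : forall x : R -> J -> R,
  (forall k, continuous (fun t => x t k)) -> forall j, continuous (fun t => f t (x t) j).
Hypothesis f_lip : forall (t : R) x y b, 0 <= b ->
  (forall k, `|x k - y k| <= b * w k `|t|) ->
  forall j, `|f t x j - f t y j| <= b / 2 * dw j `|t|.
Hypothesis f_init : forall (t : R) j, `|f t x0 j| <= B * dw j `|t|.

Let w_mono j (s t : R) : 0 <= s <= t -> w j s <= w j t.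
Proof.
case/andP => s0 st; apply: (@deriv_ge0_le R _ (dw j)) => // r /andP[sr _].
  by apply: w_der; lra.
by apply: dw_ge0; lra.
Qed.

(** The Lipschitz bound is measured by [dw], the time derivative of the weight, so integrating it
    returns [w] itself and each iteration halves the constant. No short time interval is needed, and
    nothing has to be glued. *)
Lemma picard_global : exists x : R -> J -> R, [/\ x 0 = x0,
  (forall (t : R) j, is_derive t 1 (fun s => x s j) (f t (x t) j)) &
  (forall t j, `|x t j - x0 j| <= 2 * B * w j `|t|)].
Proof.
(* The default 0 for discontinuous functions makes the Picard step a total function; every iterate
   is continuous, so the default is never met. *)
pose AD (g : R -> R) : R -> R :=
  if pselect (continuous g) is left gc then sval (cid (antiderivative gc)) else 0.
have ADP (g : R -> R) : continuous g ->
    (forall t : R, is_derive t 1 (AD g) (g t)) /\ AD g 0 = 0.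
  by rewrite /AD; case: pselect => // gc _; case: cid.
pose step (x : R -> J -> R) : R -> J -> R :=
  fun t j => x0 j + AD (fun s => f s (x s) j) t.
pose X n := iter n step (fun _ => x0).
have step_der (x : R -> J -> R) : (forall k, continuous (fun t => x t k)) ->
    forall j (t : R), is_derive t 1 (fun s => step x s j) (f t (x t) j).
  move=> xc j t; have [h _] := ADP _ (@f_cont _ xc j).
  by apply: (pder_eq (pderD (pderC t (x0 j)) (h t))); rewrite add0r.
have step_cont (x : R -> J -> R) : (forall k, continuous (fun t => x t k)) ->
    forall k, continuous (fun t => step x t k).
  by move=> xc k t; exact: is_derive_cont (step_der _ xc k t).
have step0 (x : R -> J -> R) : (forall k, continuous (fun t => x t k)) ->
    forall j, step x 0 j = x0 j.
  by move=> xc j; rewrite /step; have [_ ->] := ADP _ (@f_cont _ xc j); rewrite addr0.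
have Xc n k : continuous (fun t => X n t k).
  elim: n k => [|n IH] k; first by move=> t; exact: cvg_cst.
  exact: step_cont.
have step_lip (x y : R -> J -> R) b : 0 <= b ->
    (forall k, continuous (fun t => x t k)) -> (forall k, continuous (fun t => y t k)) ->
    (forall (t : R) k, `|x t k - y t k| <= b * w k `|t|) ->
    forall (t : R) j, `|step x t j - step y t j| <= b / 2 * w j `|t|.
  move=> b0 xc yc xy t j.
  apply: (@deriv_dom_le_sym R `|t| (fun s => step x s j - step y s j)
     (fun s => f s (x s) j - f s (y s) j) (fun s => b / 2 * w j s) (fun s => b / 2 * dw j s)
     (fun s _ => pderB (step_der _ xc j s) (step_der _ yc j s))
     (fun s s0 => pderZ _ (w_der j s0))) => //.
  - by move=> s _; apply: f_lip.
  - by rewrite !step0 // subrr normr0 mulr_ge0 ?w_ge0 ?divr_ge0.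
have Xdiff n : forall (t : R) j, `|X n.+1 t j - X n t j| <= B / 2 ^+ n * w j `|t|.
  elim: n => [|n IH] t j.
    rewrite expr0 divr1.
    apply: (@deriv_dom_le_sym R `|t| (fun s => X 1%N s j - x0 j)
      (fun s => f s x0 j - 0) (fun s => B * w j s) (fun s => B * dw j s)) => //.
    - by move=> s _; apply: pderB (pderC _ _); apply: step_der => k r; exact: cvg_cst.
    - by move=> s s0; exact: pderZ (w_der _ s0).
    - by move=> s _; rewrite subr0.
    - rewrite (_ : X 1%N = step (fun _ => x0)) // step0; last by move=> k r; exact: cvg_cst.
      by rewrite subrr normr0 mulr_ge0 ?w_ge0.
  have -> : B / 2 ^+ n.+1 = B / 2 ^+ n / 2 by rewrite exprS invfM mulrA mulrAC.
  apply: (step_lip _ _ _ _ (Xc n.+1) (Xc n) IH).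
  by rewrite divr_ge0 // exprn_ge0.
have lim t j : exists l, forall n, `|X n t j - l| <= 2 * B * w j `|t| / 2 ^+ n.
  have [|n|l lP] := @geometric_limit R (fun n => X n t j) (B * w j `|t|).
  - by rewrite mulr_ge0 // w_ge0.
  - by rewrite mulrAC; exact: Xdiff.
  - by exists l => n; rewrite -(mulrA 2 B); exact: lP.
pose x t j := sval (cid (lim t j)).
have xP t j n : `|X n t j - x t j| <= 2 * B * w j `|t| / 2 ^+ n.
  by rewrite /x; case: cid.
have xc j : continuous (fun t => x t j).
  apply: (@continuous_unif_limit R (fun n t => X n t j) _ (w j) (2 * B)) => //.
  - by rewrite mulr_ge0.
  - by move=> s t; exact: w_mono.
(* Both [x] and [step x] are close to [X n.+1], the latter because [step] contracts the distance
   from [X n] to [x]. *)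
have xfix : x = step x.
  apply/funext => t; apply/funext => j; apply/eqP; rewrite -subr_eq0 -normr_le0.
  apply: (@halving_le R _ _ (2 * (2 * B * w j `|t|))) => n; rewrite add0r.
  have h1 := xP t j n.+1.
  have h2 : `|X n.+1 t j - step x t j| <= 2 * B / 2 ^+ n / 2 * w j `|t|.
    apply: step_lip => //.
    - by rewrite divr_ge0 ?mulr_ge0 // exprn_ge0.
    - by move=> s k; rewrite mulrAC; exact: xP.
  have p : 0 <= 2 * B * w j `|t| / 2 ^+ n.
    by rewrite divr_ge0 ?exprn_ge0 // !mulr_ge0 // w_ge0.
  have e1 : 2 * B * w j `|t| / 2 ^+ n.+1 = 2 * B * w j `|t| / 2 ^+ n / 2.
    by rewrite exprS invfM mulrA mulrAC.
  have e2 : 2 * B / 2 ^+ n / 2 * w j `|t| = 2 * B * w j `|t| / 2 ^+ n / 2 by ring.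
  rewrite e1 in h1; rewrite e2 in h2.
  have -> : 2 * (2 * B * w j `|t|) / 2 ^+ n = 2 * (2 * B * w j `|t| / 2 ^+ n) by ring.
  move: h1 h2 p; set A := 2 * B * w j `|t| / 2 ^+ n; rewrite !ler_norml => /andP[? ?] /andP[? ?] ?.
  by apply/andP; split; lra.
exists x; split.
- by apply/funext => j; rewrite xfix step0.
- by move=> t j; rewrite {1}xfix; exact: step_der.
- move=> t j; have := xP t j 0%N.
  by rewrite expr0 divr1 distrC.
Qed.

End Picard.

(** * Stability, Gronwall chains and local boundedness *)

Lemma pder_expR_aff (R : realType) (t a c : R) :
  is_derive t 1 (fun s => expR (a + c * s)) (c * expR (a + c * t)).
Proof. exact: is_derive_aff (is_derive_expR _). Qed.

(** The a priori constant [B] only starts the iteration b -> b / 2 + eps, whose fixed point 2 eps is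
    the bound obtained. *)
Lemma weighted_stability (R : realType) (J : Type) (T eps B : R)
  (z dz : R -> J -> R) (w dw : J -> R -> R) : 0 <= eps -> 0 <= B ->
  (forall j (t : R), 0 <= t -> is_derive t 1 (w j) (dw j t)) ->
  (forall j (t : R), 0 <= t -> 0 <= w j t) ->
  (forall (t : R) j, `|t| <= T -> is_derive t 1 (fun s => z s j) (dz t j)) ->
  (forall (t b : R), `|t| <= T -> 0 <= b -> (forall k, `|z t k| <= b * w k `|t|) ->
     forall j, `|dz t j| <= (b / 2 + eps) * dw j `|t|) ->
  (forall j, `|z 0 j| <= eps * w j 0) ->
  (forall t j, `|t| <= T -> `|z t j| <= B * w j `|t|) ->
  forall t j, `|t| <= T -> `|z t j| <= 2 * eps * w j `|t|.
Proof.
move=> e0 B0 wd w0 zd zl z0 zB t j tT.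
have p n : 0 <= B / 2 ^+ n by rewrite divr_ge0 // exprn_ge0.
have key n : forall s k, `|s| <= T -> `|z s k| <= (2 * eps + B / 2 ^+ n) * w k `|s|.
  elim: n => [|n IH] s k sT.
    apply: (le_trans (zB s k sT)); rewrite expr0 divr1.
    by rewrite ler_wpM2r ?w0 //; lra.
  have -> : 2 * eps + B / 2 ^+ n.+1 = (2 * eps + B / 2 ^+ n) / 2 + eps.
    by rewrite exprS invfM; field; rewrite expf_neq0.
  set b := 2 * eps + _ in IH *.
  have b0 : 0 <= b by rewrite addr_ge0 // mulr_ge0.
  move: b b0 IH => b b0 IH {p}.
  apply: (@deriv_dom_le_sym R T (fun s => z s k) (fun s => dz s k)
    (fun s => (b / 2 + eps) * w k s) (fun s => (b / 2 + eps) * dw k s)); last exact: sT.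
  - by move=> r r0; exact: pderZ (wd _ _ r0).
  - by move=> r rT; apply: zl => // i; exact: IH.
  - apply: (le_trans (z0 k)); rewrite ler_wpM2r ?w0 //; lra.
apply: (@halving_le R _ _ (B * w j `|t|)) => n.
by rewrite (mulrAC B) -mulrDl; exact: key.
Qed.

(** The comparison function has two parts: N e^(Ct) solves the chain with equality, and the a priori
    growth is carried by e^(Dk + mu t), whose coefficient is halved at each pass and tends to 0. *)
Lemma gronwall_chain (R : realType) (T C N B D : R) (s ds : nat -> R -> R) :
  0 <= C -> 0 <= N -> 0 <= B ->
  (forall k (t : R), 0 <= t <= T -> is_derive t 1 (s k) (ds k t)) ->
  (forall k t, 0 <= t <= T -> `|ds k t| <= C * s k.+1 t) ->
  (forall k t, 0 <= t <= T -> 0 <= s k t) ->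
  (forall k, s k 0 <= N) ->
  (forall k t, 0 <= t <= T -> s k t <= B * expR (D * k%:R)) ->
  forall k t, 0 <= t <= T -> s k t <= N * expR (C * t).
Proof.
move=> C0 N0 B0 sd sl s0 sN sB k t tT.
(* Passing from k to k + 1 costs the factor C e^D, which is mu / 2: this is where the halving comes
   from. *)
pose mu := 2 * C * expR D.
have mu0 : 0 <= mu by rewrite !mulr_ge0 // expR_ge0.
have p n : 0 <= B / 2 ^+ n by rewrite divr_ge0 // exprn_ge0.
have key n : forall k r, 0 <= r <= T ->
    s k r <= N * expR (0 + C * r) + B / 2 ^+ n * expR (D * k%:R + mu * r).
  elim: n => [|n IH] i r rT.
    apply: (le_trans (sB i r rT)); rewrite expr0 divr1 ler_wpDl //.
      by rewrite mulr_ge0 // expR_ge0.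
    rewrite ler_wpM2l // ler_expR; case/andP: rT => r0 _.
    by rewrite lerDl mulr_ge0.
  have -> : B / 2 ^+ n.+1 = B / 2 ^+ n / 2 by rewrite exprS invfM mulrA mulrAC.
  set b := B / 2 ^+ n in IH *.
  have b0 : 0 <= b by exact: p.
  move: b b0 IH => b b0 IH {p}.
  rewrite -[s i r]ger0_norm ?s0 //; case/andP: rT => r0 rT.
  have inT x : 0 <= x <= r -> 0 <= x <= T by case/andP => -> /le_trans; apply.
  apply: (@deriv_dom_le R (s i) (ds i) (fun x => N * expR (0 + C * x) + b / 2 * expR (D * i%:R + mu * x))
    (fun x => N * (C * expR (0 + C * x)) + b / 2 * (mu * expR (D * i%:R + mu * x))) 0 r); first exact: r0.
  - by move=> x /inT; exact: sd.
  - by move=> x _; exact: pderD (pderZ _ (pder_expR_aff _ _ _)) (pderZ _ (pder_expR_aff _ _ _)).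
  - move=> x /inT xT; apply: (le_trans (sl i x xT)).
    apply: (le_trans (ler_wpM2l C0 (IH i.+1 x xT))).
    have -> : D * i.+1%:R + mu * x = D + (D * i%:R + mu * x) by rewrite -natr1; ring.
    by rewrite expRD /mu le_eqVlt; apply/orP; left; apply/eqP; field.
  - rewrite ger0_norm ?s0 ?lexx ?(le_trans r0 rT) //.
    rewrite !mulr0 !addr0 expR0 mulr1 (le_trans (sN i)) // lerDl.
    by rewrite mulr_ge0 ?divr_ge0 // expR_ge0.
apply: (@halving_le R _ _ (B * expR (D * k%:R + mu * t))) => n.
by have := key n k t tT; rewrite add0r mulrAC.
Qed.

Section LocalBoundedness.
Variable R : realType.
Implicit Types (s : nat -> R -> R) (C m t : R).

Let bdd s (x y : R) := exists M, forall k t, x <= t <= y -> s k t <= M.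

(** [M] is absent from the conclusion: a bound has to exist on the interval, but its size is
    irrelevant. Providing its existence is the purpose of this section. *)
Let fwd_gronwall s C := forall (a b M m : R), a <= b ->
  (forall k t, a <= t <= b -> s k t <= M) ->
  (forall k, s k a <= m) -> forall k, s k b <= m * expR (C * (b - a)).

Let bwd_gronwall s C := forall (a b M m : R), a <= b ->
  (forall k t, a <= t <= b -> s k t <= M) ->
  (forall k, s k b <= m) -> forall k, s k a <= m * expR (C * (b - a)).

(** Let r be the last time up to t at which the bound m holds; it is attained because the sublevel
    set is closed. Each [u, t] with u > r contains no such time, hence is bounded, and the backward
    estimate from t gives a bound there independent of u. So s is bounded on [r, t], and the forward
    estimate starts from m at r. *)
Lemma gronwall_after_sublevel s C m (z t : R) : 0 <= C ->
  (forall k, continuous (s k)) -> (forall k t, 0 <= s k t) ->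
  (exists M, forall k, s k t <= M) -> fwd_gronwall s C -> bwd_gronwall s C ->
  z <= t -> (forall k, s k z <= m) ->
  (forall u, z <= u <= t -> (forall v, u <= v <= t -> ~ forall k, s k v <= m) -> bdd s u t) ->
  forall k, s k t <= m * expR (C * (t - z)).
Proof.
move=> C0 sc s0 [M0 HM0] fwd bwd zt Zz good k.
pose Z := [set r | forall k, s k r <= m].
have Zclosed : closed Z.
  rewrite (_ : Z = \bigcap_(k in setT) (s k @^-1` [set x | x <= m])).
    apply: closed_bigI => i _; apply: closed_comp; last exact: closed_le.
    by move=> r _; exact: sc.
  by apply/seteqP; split => r /= h i; [move=> _; exact: h|exact: h].
pose A := [set r | z <= r <= t /\ Z r].
have Az : A z by split => //; rewrite lexx.
have Aub : ubound A t by move=> r [/andP[_ ?] _].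
pose r := sup A.
have zr : z <= r by apply: ub_le_sup => //; exists t.
have rt : r <= t by apply: ge_sup => //; exists z.
have Zr : Z r.
  have : closure Z r by apply: (@closureS _ A) => [x []//|]; apply: closure_sup; [exists z|exists t].
  by rewrite -(closure_id _).1.
have after u i : r < u <= t -> s i u <= M0 * expR (C * (t - r)).
  case/andP => ru ut.
  have [M HM] : bdd s u t.
    apply: good => [|v /andP[uv vt] Zv]; first by rewrite ut andbT; lra.
    have : v <= r by apply: ub_le_sup; [exists t|split => //; apply/andP; split; lra].
    lra.
  apply: (le_trans (bwd u t M M0 ut HM HM0 i)).
  rewrite ler_wpM2l ?(le_trans (s0 0%N t) (HM0 0%N)) //.
  by rewrite ler_expR ler_wpM2l //; lra.
have HM i u : r <= u <= t -> s i u <= Num.max m (M0 * expR (C * (t - r))).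
  case/andP; rewrite le_eqVlt => /orP[/eqP <- _|ru ut]; rewrite le_max; first by rewrite Zr.
  by rewrite after ?ru ?orbT.
apply: (le_trans (fwd r t _ m rt HM Zr k)).
rewrite ler_wpM2l ?(le_trans (s0 0%N z) (Zz 0%N)) //.
by rewrite ler_expR ler_wpM2l //; lra.
Qed.

(* Baire-type argument: if [s] were unbounded on [[a, b]], every bad interval
   would contain, for each m, a bad subinterval throughout which the bound [m]
   fails; a point common to a nested sequence of those violates the pointwise bound. *)
Lemma ptw_bounded_locally_bounded s C : 0 <= C ->
  (forall k, continuous (s k)) -> (forall k t, 0 <= s k t) ->
  (forall t, exists m, forall k, s k t <= m) ->
  fwd_gronwall s C -> bwd_gronwall s C ->
  forall a b, a <= b -> exists M, forall k t, a <= t <= b -> s k t <= M.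
Proof.
move=> C0 sc s0 ptw fwd bwd a b ab.
pose Z m t := forall k, s k t <= m.
have bad_sub m x y : x <= y -> ~ bdd s x y -> exists x' y',
    [/\ x <= x', x' <= y', y' <= y, ~ bdd s x' y' & forall t, x' <= t <= y' -> ~ Z m t].
  move=> xy bad; apply: contrapT => none; apply: bad.
  have good x' y' : x <= x' -> x' <= y' -> y' <= y ->
      (forall t, x' <= t <= y' -> ~ Z m t) -> bdd s x' y'.
    by move=> h1 h2 h3 h4; apply: contrapT => h5; apply: none; exists x', y'; split.
  have [[z [zxy Zz]]|noZ] := pselect (exists z, x <= z <= y /\ Z m z); last first.
    by apply: good => // t txy Zt; apply: noZ; exists t.
  have m0 : 0 <= m by exact: le_trans (s0 0%N z) (Zz 0%N).
  exists (m * expR (C * (y - x))) => k t txy.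
  case/andP: (txy) => xt ty; case/andP: zxy => xz zy.
  have [zt|tz] := leP z t.
    apply: le_trans (@gronwall_after_sublevel s C m z t C0 sc s0 (ptw t) fwd bwd zt Zz _ k) _.
      by move=> u /andP[zu ut] hu; apply: good => //; lra.
    by rewrite ler_wpM2l // ler_expR ler_wpM2l //; lra.
  (* Times before z are treated by reflecting time, which exchanges the forward and the backward
     estimate. *)
  have := @gronwall_after_sublevel (fun k r => s k (- r)) C m (- z) (- t) C0 _ _ _ _ _ _ _ _ k.
  rewrite opprK => h; apply: (le_trans (h _ _ _ _ _ _ _ _)) => {h}.
  - move=> i r; apply: continuous_comp; last exact: sc.
    exact: opp_continuous.
  - by move=> *; exact: s0.
  - exact: ptw.
  - move=> a' b' M m' ab' hM hm i.
    have -> : b' - a' = - a' - - b' by ring.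
    apply: (bwd (- b') (- a') M m'); [lra| |exact: hm].
    by move=> i' r rab; rewrite -[r]opprK; apply: hM; lra.
  - move=> a' b' M m' ab' hM hm i.
    have -> : b' - a' = - a' - - b' by ring.
    apply: (fwd (- b') (- a') M m'); [lra| |exact: hm].
    by move=> i' r rab; rewrite -[r]opprK; apply: hM; lra.
  - lra.
  - by move=> i; rewrite opprK; exact: Zz.
  - move=> u uzt hu.
    have [||||M HM] := good t (- u); try lra.
      move=> v vtu Zv; apply: (hu (- v)); first by lra.
      by move=> i; rewrite opprK; exact: Zv.
    by exists M => i r rut; apply: HM; lra.
  - by rewrite ler_wpM2l // ler_expR ler_wpM2l //; lra.
apply: contrapT => bad0.
(* Bad intervals are packaged with the proof that they are bad, so the recursion can go on; its step
   m avoids the sublevel set of height m. *)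
pose I := {p : R * R | p.1 <= p.2 /\ ~ bdd s p.1 p.2}.
have next (m : nat) (p : I) : {q : I | (sval p).1 <= (sval q).1 /\ (sval q).2 <= (sval p).2 /\
    forall t, (sval q).1 <= t <= (sval q).2 -> ~ Z m%:R t}.
  apply: cid; case: p => p [p12 pb] /=.
  have [x' [y' [h1 h2 h3 h4 h5]]] := bad_sub m%:R p.1 p.2 p12 pb.
  by exists (exist _ (x', y') (conj h2 h4)).
pose p0 : I := exist _ (a, b) (conj ab bad0).
pose seq := fix seq n : I := if n is m.+1 then sval (next m (seq m)) else p0.
have sq n : (sval (seq n)).1 <= (sval (seq n.+1)).1 /\ (sval (seq n.+1)).2 <= (sval (seq n)).2 /\
    forall t, (sval (seq n.+1)).1 <= t <= (sval (seq n.+1)).2 -> ~ Z n%:R t.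
  by rewrite /=; case: (next n (seq n)).
have [|||t tP] := @nested_intervals R (fun n => (sval (seq n)).1) (fun n => (sval (seq n)).2).
- by move=> n; case: (sq n).
- by move=> n; case: (sq n) => _ [].
- by move=> n; case: (seq n) => p [].
have [M HM] := ptw t.
have [_ [_ h]] := sq (Num.bound M).
apply: (h t (tP _)) => k; apply: (le_trans (HM k)).
have M0 := le_trans (s0 0%N t) (HM 0%N).
exact/ltW/archi_boundP.
Qed.

End LocalBoundedness.

(** * Weights *)

Section Weights.
Variable R : realType.

Lemma ln_le_tangent (x y : R) : 0 < x -> 0 < y -> ln x <= x / y - 1 + ln y.
Proof.
move=> x0 y0; have xy : 0 < x / y by rewrite divr_gt0.
rewrite -[x in ln x](divfK (lt0r_neq0 y0)) lnM ?posrE // lerD2r.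
rewrite -ler_expR lnK ?posrE //; have := expR_ge1Dx (x / y - 1); lra.
Qed.

(* [wt a c r t] grows by at most a factor e when r increases by 1, yet
   its time derivative gains the unbounded factor [c * ln (e + r)]. *)
Definition wt (a c r t : R) := expR ((a + c * t) * ln ((a + expR 1 + r) + c * t)).
Definition dwt (a c r t : R) :=
  ((a + c * t) * (c / ((a + expR 1 + r) + c * t)) + c * ln ((a + expR 1 + r) + c * t))
  * wt a c r t.

Variables a c r : R.
Hypotheses (a1 : 1 <= a) (c0 : 0 <= c) (r0 : 0 <= r).

Lemma wt_arg_ge (t : R) : 0 <= t -> expR 1 + r <= a + expR 1 + r + c * t.
Proof. by move=> t0; have := a1; have := r0; have := mulr_ge0 c0 t0; lra. Qed.

Lemma wt_arg_gt0 (t : R) : 0 <= t -> 0 < a + expR 1 + r + c * t.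
Proof. by move=> t0; have := r0; have := wt_arg_ge t0; have := expR_gt0 (1 : R); lra. Qed.

Lemma ln_expR1_ge1 (x : R) : expR 1 <= x -> 1 <= ln x.
Proof.
move=> h; rewrite -[leLHS]expRK ler_ln ?posrE ?expR_gt0 //.
exact: lt_le_trans h.
Qed.

Lemma ell_ge1 : 1 <= ln (expR 1 + r).
Proof. by apply: ln_expR1_ge1; rewrite lerDl. Qed.

Lemma ell_le_wt_ln (t : R) : 0 <= t -> ln (expR 1 + r) <= ln (a + expR 1 + r + c * t).
Proof.
move=> t0; rewrite ler_ln ?posrE ?wt_arg_ge ?wt_arg_gt0 //.
by have := r0; have := expR_gt0 (1 : R); lra.
Qed.

Lemma wt_der (t : R) : 0 <= t -> is_derive t 1 (wt a c r) (dwt a c r t).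
Proof.
move=> t0.
have d1 (b : R) : is_derive t 1 (fun s => b + c * s) c.
  by apply: (pder_eq (pderD (pderC t b) (pderZ c (pder_id t)))); rewrite add0r mulr1.
have d2 : is_derive t 1 (fun s => ln ((a + expR 1 + r) + c * s)) (c / (a + expR 1 + r + c * t)).
  apply: (pder_eq (@pder_comp R t (@ln R) _ _ _ (is_derive1_ln (wt_arg_gt0 t0)) (d1 _))).
  by rewrite mulrC.
apply: (pder_eq (@pder_comp R t (@expR R) _ _ _ (is_derive_expR _) (pderM (d1 a) d2))).
by rewrite /dwt /wt; ring.
Qed.

Lemma wt_ge_arg (t : R) : 0 <= t -> expR 1 + r <= wt a c r t.
Proof.
move=> t0; apply: (le_trans (wt_arg_ge t0)).
rewrite -[leLHS]lnK ?posrE ?wt_arg_gt0 // ler_expR ler_peMl //.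
  by apply: le_trans (ell_le_wt_ln t0); apply: le_trans ell_ge1.
by have := a1; have := r0; have := mulr_ge0 c0 t0; lra.
Qed.

Lemma ell_le_wt (t : R) : 0 <= t -> ln (expR 1 + r) <= wt a c r t.
Proof.
move=> t0; apply: le_trans (wt_ge_arg t0).
have e0 := expR_gt0 (1 : R); have a1' := a1; have r0' := r0.
by have := @ln_le_tangent (expR 1 + r) 1; rewrite ln1 divr1; lra.
Qed.

Lemma wt_ge1 (t : R) : 0 <= t -> 1 <= wt a c r t.
Proof. by move=> t0; apply: le_trans (ell_le_wt t0); exact: ell_ge1. Qed.

Lemma wt_ge0 (t : R) : 0 <= wt a c r t.
Proof. exact: expR_ge0. Qed.

Lemma dwt_ge (t : R) : 0 <= t -> c * ln (expR 1 + r) * wt a c r t <= dwt a c r t.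
Proof.
move=> t0; rewrite /dwt ler_wpM2r ?wt_ge0 //.
have h : 0 <= (a + c * t) * (c / (a + expR 1 + r + c * t)).
  apply: mulr_ge0; first by have := a1; have := r0; have := mulr_ge0 c0 t0; lra.
  by rewrite divr_ge0 // ltW // wt_arg_gt0.
by have := ler_wpM2l c0 (ell_le_wt_ln t0); lra.
Qed.

Lemma dwt_ge0 (t : R) : 0 <= t -> 0 <= dwt a c r t.
Proof.
move=> t0; apply: le_trans (dwt_ge t0).
by rewrite !mulr_ge0 ?wt_ge0 // (le_trans _ ell_ge1).
Qed.

Lemma wt_mono (s t : R) : 0 <= s <= t -> wt a c r s <= wt a c r t.
Proof.
case/andP => s0 st; apply: (@deriv_ge0_le R _ (dwt a c r)) => // x /andP[sx _].
  by apply: wt_der; lra.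
by apply: dwt_ge0; lra.
Qed.

(** Let A be the argument of the logarithm at r. Moving r by 1 raises the logarithm by at most 1 /
    A, and the prefactor a + c t is at most A since it is also a summand of A. *)
Lemma wt_next (r' t : R) : 0 <= t -> 0 <= r' -> r' <= r + 1 ->
  wt a c r' t <= expR 1 * wt a c r t.
Proof.
move=> t0 r'0 rr; rewrite -expRD ler_expR.
have act : 0 <= a + c * t by have := a1; have := r0; have := mulr_ge0 c0 t0; lra.
have A0 := wt_arg_gt0 t0.
set A := a + expR 1 + r + c * t in A0 *.
have e0 := expR_gt0 (1 : R); have a1' := a1; have r0' := r0.
have h : ln (a + expR 1 + r' + c * t) <= 1 / A + ln A.
  have := @ln_le_tangent (a + expR 1 + r' + c * t) A _ A0.
  have -> : 0 < a + expR 1 + r' + c * t by lra.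
  move=> /(_ isT) /le_trans; apply.
  have : (a + expR 1 + r' + c * t) / A <= (A + 1) / A.
    by rewrite ler_pM2r ?invr_gt0 // /A; have := r0; have := a1; lra.
  have -> : (A + 1) / A = 1 + 1 / A by field; rewrite lt0r_neq0.
  lra.
apply: (le_trans (ler_wpM2l act h)); rewrite mulrDr lerD2r mulrA mulr1.
by rewrite ler_pdivrMr // mul1r /A; have := r0; lra.
Qed.

(** Squaring doubles the exponent, hence a and c; doubling them inside the logarithm too only helps.
    Second-order remainders are thus measured in a weight of the same family. *)
Lemma wt_sq (t : R) : 0 <= t -> wt a c r t ^+ 2 <= wt (2 * a) (2 * c) r t.
Proof.
move=> t0; rewrite -expRM_natl ler_expR.
have ct := mulr_ge0 c0 t0; have a1' := a1; have r0' := r0.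
have -> : 2 * ((a + c * t) * ln (a + expR 1 + r + c * t)) =
   (2 * a + 2 * c * t) * ln (a + expR 1 + r + c * t) by ring.
apply: ler_wpM2l; first lra.
by rewrite ler_ln ?posrE; have := wt_arg_gt0 t0; lra.
Qed.

End Weights.

(** The tangent to ln at y = (n + 1)(a + cT) makes the exponent grow in r with slope exactly 1. This
    yields the exponential a priori bound that [gronwall_chain] requires. *)
Lemma wt_subexp (R : realType) (a c T : R) (n : nat) : 1 <= a -> 0 <= c -> 0 <= T ->
  exists2 B : R, 0 <= B & forall r t, 0 <= r -> 0 <= t <= T -> wt a c r t ^+ n.+1 <= B * expR r.
Proof.
move=> a1 c0 T0.
have act : 0 < a + c * T by have := mulr_ge0 c0 T0; lra.
pose y := n.+1%:R * (a + c * T).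
have y0 : 0 < y by rewrite mulr_gt0.
exists (expR (a + expR 1 + c * T - y + y * ln y)); first exact: expR_ge0.
move=> r t r0 tT.
have h : wt a c r t <= wt a c r T by exact: wt_mono.
apply: (le_trans (lerXn2r n.+1 (wt_ge0 a c r t) (wt_ge0 a c r T) h)).
rewrite -expRM_natl -expRD ler_expR mulrA -/y.
have A0 := wt_arg_gt0 a1 c0 r0 T0.
have := ler_wpM2l (ltW y0) (ln_le_tangent A0 y0).
set A := a + expR 1 + r + c * T.
have -> : y * (A / y - 1 + ln y) = A - y + y * ln y by field; rewrite lt0r_neq0.
by rewrite /A; lra.
Qed.

(** * Geometry of cubes *)

Section CubeGeometry.
Variable d : nat.
Implicit Types (nu i j : site d).

Lemma absz_addB_le (a : int) (o k : nat) : (o <= k.*2)%N ->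
  (absz (a + o%:Z - k%:Z)%R <= absz a + k)%N.
Proof. by move=> h; lia. Qed.

Lemma lnorm_cube_pt nu k o : (lnorm (cube_pt nu k o) <= lnorm nu + d * k)%N.
Proof.
rewrite /lnorm (_ : (d * k)%N = (\sum_(l < d) k)%N); last by rewrite sum_nat_const card_ord.
rewrite -big_split /=; apply: leq_sum => l _; rewrite ffunE.
by apply: absz_addB_le; have := ltn_ord (o l); rewrite ltnS.
Qed.

Lemma lnorm_ldist i j : (lnorm j <= lnorm i + ldist j i)%N.
Proof.
rewrite /lnorm /ldist -big_split /=; apply: leq_sum => l _.
by lia.
Qed.

Lemma ldistC i j : ldist i j = ldist j i.
Proof. by apply: eq_bigr => l _; lia. Qed.

Lemma ldist_coord i j l : (absz (i l - j l)%R <= ldist i j)%N.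
Proof. by rewrite /ldist (bigD1 l) //= leq_addr. Qed.

Lemma cube_pt_inj nu k : injective (@cube_pt d nu k).
Proof.
move=> o o' /ffunP h; apply/ffunP => l; apply/val_inj => /=.
by have := h l; rewrite !ffunE; lia.
Qed.

Definition cube_center k : {ffun 'I_d -> 'I_(k.*2.+1)} := [ffun=> inord k].

Lemma cube_pt_center nu k : cube_pt nu k (cube_center k) = nu.
Proof. by apply/ffunP => l; rewrite !ffunE inordK ?addrK //; lia. Qed.

(** Offsets are counted from the corner and the centres k and 1 add up to k + 1, so composing a cube
    with a neighbourhood is plain addition. The sum is at most 2k + 2, so [inord] never falls back
    to its default. *)
Definition cube_shift k (e : {ffun 'I_d -> 'I_(1%N.*2.+1)}) (o : {ffun 'I_d -> 'I_(k.*2.+1)}) :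
  {ffun 'I_d -> 'I_(k.+1.*2.+1)} := [ffun l => inord (o l + e l)].

Lemma cube_shift_val k e (o : {ffun 'I_d -> 'I_(k.*2.+1)}) l :
  cube_shift e o l = (o l + e l)%N :> nat.
Proof. by rewrite ffunE inordK //; have := ltn_ord (o l); have := ltn_ord (e l); lia. Qed.

Lemma cube_pt_shift nu k e o :
  cube_pt (cube_pt nu k o) 1 e = cube_pt nu k.+1 (cube_shift e o).
Proof. by apply/ffunP => l; rewrite [RHS]ffunE cube_shift_val !ffunE; lia. Qed.

Lemma cube_shift_inj k e : injective (@cube_shift k e).
Proof.
move=> o o' /ffunP h; apply/ffunP => l; apply/val_inj => /=.
by have := congr1 val (h l); rewrite /= !cube_shift_val; lia.
Qed.

Lemma card_cube k : #|{ffun 'I_d -> 'I_(k.*2.+1)}| = (k.*2.+1 ^ d)%N.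
Proof. by rewrite card_ffun !card_ord. Qed.

Lemma card_nbr nu k (o1 : {ffun 'I_d -> 'I_(k.*2.+1)}) :
  (#|[set o2 | ldist (cube_pt nu k o2) (cube_pt nu k o1) == 1%N]| <= 3 ^ d)%N.
Proof.
(* The relative offset, raised by 1 to lie in {0, 1, 2}. For neighbours the subtraction does not
   truncate, so [phi] is injective on them. *)
pose phi (o2 : {ffun 'I_d -> 'I_(k.*2.+1)}) : {ffun 'I_d -> 'I_(1%N.*2.+1)} :=
  [ffun l => inord ((o2 l).+1 - o1 l)].
have close (o2 : {ffun 'I_d -> 'I_(k.*2.+1)}) l :
    ldist (cube_pt nu k o2) (cube_pt nu k o1) == 1%N ->
    (o2 l <= o1 l + 1)%N /\ (o1 l <= o2 l + 1)%N.
  by move=> /eqP h; have := ldist_coord (cube_pt nu k o2) (cube_pt nu k o1) l; rewrite h !ffunE; lia.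
rewrite -(card_cube 1) -(@card_in_imset _ _ phi).
  exact: max_card.
move=> o o'; rewrite !inE => ho ho' /ffunP h; apply/ffunP => l; apply/val_inj => /=.
have := congr1 val (h l); rewrite /= !ffunE.
by have [? ?] := close _ l ho; have [? ?] := close _ l ho'; rewrite !inordK; lia.
Qed.

End CubeGeometry.

Section CubeSums.
Variables (R : realType) (d : nat).
Implicit Types (g : site d -> R) (nu : site d).

Lemma sum_inj_le (I J : finType) (phi : I -> J) (g : J -> R) :
  injective phi -> (forall j, 0 <= g j) -> \sum_i g (phi i) <= \sum_j g j.
Proof.
move=> pinj g0.
have -> : \sum_i g (phi i) = \sum_(j in phi @: finset.setTfor I) g j.
  by rewrite big_imset /=; [apply: eq_bigl => i; rewrite inE|move=> x y _ _; exact: pinj].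
by rewrite [leRHS](bigID (mem (phi @: finset.setTfor I))) /= lerDl sumr_ge0.
Qed.

(** For each of the 3^d relative offsets, translation embeds the cube injectively into the cube of
    the next radius. *)
Lemma sum_cube_nbr_le g nu k : (forall i, 0 <= g i) ->
  \sum_(o : {ffun 'I_d -> 'I_(k.*2.+1)}) \sum_(e : {ffun 'I_d -> 'I_(1%N.*2.+1)})
     g (cube_pt (cube_pt nu k o) 1 e) <=
  3 ^+ d * \sum_(o : {ffun 'I_d -> 'I_(k.+1.*2.+1)}) g (cube_pt nu k.+1 o).
Proof.
move=> g0; rewrite exchange_big /=.
have -> : 3 ^+ d = #|{ffun 'I_d -> 'I_(1%N.*2.+1)}|%:R :> R by rewrite card_cube natrX.
rewrite mulr_natl -sumr_const; apply: ler_sum => e _.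
under eq_bigr do rewrite cube_pt_shift.
exact: (@sum_inj_le _ _ (@cube_shift d k e) (fun o => g (cube_pt nu k.+1 o)) (@cube_shift_inj d k e)).
Qed.

Lemma sum_nbr_pairs_le nu k (f : {ffun 'I_d -> 'I_(k.*2.+1)} -> R) : (forall o, 0 <= f o) ->
  \sum_o1 \sum_o2 (if ldist (cube_pt nu k o2) (cube_pt nu k o1) == 1%N then f o1 else 0)
  <= 3 ^+ d * \sum_o f o.
Proof.
move=> f0; rewrite mulr_sumr; apply: ler_sum => o1 _.
rewrite -big_mkcond /= sumr_const -[leLHS]mulr_natl ler_wpM2r // -natrX ler_nat.
by apply: leq_trans (card_nbr nu o1); apply: subset_leq_card; apply/fintype.subsetP => o; rewrite !inE.
Qed.

Lemma cube_size_gt0 k : 0 < (k.*2.+1)%:R ^+ d :> R.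
Proof. by rewrite exprn_gt0. Qed.

Lemma cube_size_next k : (k.+1.*2.+1)%:R ^+ d <= 3 ^+ d * (k.*2.+1)%:R ^+ d :> R.
Proof.
rewrite -exprMn lerXn2r ?nnegrE ?mulr_ge0 //.
by rewrite -natrM ler_nat; lia.
Qed.

End CubeSums.

(** * Energy estimate *)

Section Energy.
Variables (R : realType) (d : nat) (K : R).
Implicit Types (V G : site d -> R -> R) (x : state R d) (y : R -> state R d) (nu i : site d).

Definition hsite V x i : R := (x i).2 ^+ 2 / 2 + V i (x i).1 + 1.

Definition coupling x i : R :=
  \sum_(o : {ffun 'I_d -> 'I_(1%N.*2.+1)})
    (if ldist (cube_pt i 1%N o) i == 1%N then (x i).1 - (x (cube_pt i 1%N o)).1 else 0).

(** Stated at one time and with site-dependent forces, so that it covers the clipped dynamics and,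
    with [G] varying in t, the linearised equation. *)
Definition gsolves_at G y (t : R) := forall i,
  is_derive t 1 (fun s => (y s i).1) (y t i).2 /\
  is_derive t 1 (fun s => (y s i).2) (- G i (y t i).1 - K * coupling (y t) i).

Definition avg_energy V (lam : R) nu k x : R :=
  (\sum_(o : {ffun 'I_d -> 'I_(k.*2.+1)}) (hsite V x (cube_pt nu k o) + lam ^+ 4))
  / (k.*2.+1)%:R ^+ d.

Lemma hsite_der V G y (t : R) i :
  (forall q : R, is_derive q 1 (V i) (G i q)) -> gsolves_at G y t ->
  is_derive t 1 (fun s => hsite V (y s) i) (- (K * ((y t i).2 * coupling (y t) i))).
Proof.
move=> VG /(_ i) [dq dp].
have d1 := pderZ 2^-1 (pderM dp dp).
have d2 := @pder_comp R t (V i) _ _ _ (VG _) dq.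
have := pderD (pderD d1 d2) (pderC t 1).
rewrite (_ : (fun s => _) = (fun s => hsite V (y s) i)); last first.
  by apply/funext => s; rewrite /hsite expr2 mulrC.
by move/pder_eq; apply; field.
Qed.

(** Young's inequality with weight lam: 2 lam |p| |q| <= p^2 + lam^2 q^2, where both terms are
    controlled by h + lam^4. Dividing by 2 lam produces the factor 1 / lam. The two products at each
    bond use p_i^2 twice, hence the 4. *)
Lemma coupling_power_le V C1 (lam : R) x i : 0 <= K -> 0 <= C1 -> 0 < lam ->
  (forall j q, 0 <= V j q) ->
  (forall j q, lam ^+ 2 * q ^+ 2 <= C1 * (V j q + 1 + lam ^+ 4)) ->
  `|K * ((x i).2 * coupling x i)| <=
  K * 3 ^+ d * (4 + C1) / lam *
  \sum_(o : {ffun 'I_d -> 'I_(1%N.*2.+1)}) (hsite V x (cube_pt i 1 o) + lam ^+ 4).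
Proof.
move=> K0 C10 lam0 V0 Vq.
have L4 : 0 <= lam ^+ 4 by rewrite exprn_ge0 // ltW.
pose E j := hsite V x j + lam ^+ 4.
have E0 j : 0 <= E j.
  rewrite /E /hsite; have := sqr_ge0 (x j).2; have := V0 j (x j).1.
  by have := L4; lra.
have pE j : (x j).2 ^+ 2 <= 2 * E j.
  rewrite /E /hsite; have := V0 j (x j).1.
  by have := L4; lra.
have qE j : lam ^+ 2 * (x j).1 ^+ 2 <= C1 * E j.
  apply: (le_trans (Vq j _)); apply: ler_wpM2l => //.
  by rewrite /E /hsite; have := sqr_ge0 (x j).2; lra.
have term j : `|(x i).2 * ((x i).1 - (x j).1)| <= ((4 + C1) * E i + C1 * E j) / (2 * lam).
  rewrite ler_pdivlMr ?mulr_gt0 // normrM.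
  have h1 : `|(x i).1 - (x j).1| <= `|(x i).1| + `|(x j).1| by rewrite ler_normB.
  have h2 := normr_ge0 (x i).2.
  apply: le_trans (_ : `|(x i).2| * (`|(x i).1| + `|(x j).1|) * (2 * lam) <= _).
    by rewrite ler_pM2r ?mulr_gt0 // ler_wpM2l.
  have a1 : 2 * lam * `|(x i).2| * `|(x i).1| <= (x i).2 ^+ 2 + lam ^+ 2 * (x i).1 ^+ 2.
    rewrite -subr_ge0 -(real_normK (num_real (x i).2)) -(real_normK (num_real (x i).1)).
    by have := sqr_ge0 (`|(x i).2| - lam * `|(x i).1|); rewrite !expr2; lra.
  have a2 : 2 * lam * `|(x i).2| * `|(x j).1| <= (x i).2 ^+ 2 + lam ^+ 2 * (x j).1 ^+ 2.
    rewrite -subr_ge0 -(real_normK (num_real (x i).2)) -(real_normK (num_real (x j).1)).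
    by have := sqr_ge0 (`|(x i).2| - lam * `|(x j).1|); rewrite !expr2; lra.
  by have := pE i; have := qE i; have := qE j; move: a1 a2; lra.
rewrite normrM (ger0_norm K0) -!mulrA ler_wpM2l // /coupling mulr_sumr.
apply: (le_trans (ler_norm_sum _ _ _)).
pose S := \sum_(o : {ffun 'I_d -> 'I_(1%N.*2.+1)}) E (cube_pt i 1 o).
have ES : E i <= S.
  rewrite /S (bigD1 (cube_center d 1)) //= cube_pt_center lerDl sumr_ge0 //.
apply: le_trans (_ : \sum_(o : {ffun 'I_d -> 'I_(1%N.*2.+1)})
    ((4 + C1) * E i + C1 * E (cube_pt i 1 o)) / (2 * lam) <= _).
  apply: ler_sum => o _; case: ifP => _; first exact: term.
  rewrite mulr0 normr0 divr_ge0 ?mulr_ge0 ?(ltW lam0) // addr_ge0 ?mulr_ge0 //.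
  by rewrite addr_ge0.
rewrite -mulr_suml big_split /= sumr_const -mulr_sumr -/S card_cube -[(_ * _) *+ _]mulr_natl natrX.
set c : R := 1%N.*2.+1%:R ^+ d.
have c1 : 1 <= c by rewrite exprn_ege1 // ler1n.
rewrite [_ / (2 * lam)](_ : _ = (c * ((4 + C1) * E i) + C1 * S) / 2 * lam^-1); last first.
  by rewrite invfM [LHS]mulrA.
rewrite [leRHS](_ : _ = c * (4 + C1) * S * lam^-1); last by ring.
rewrite ler_pM2r ?invr_gt0 //.
have h : c * ((4 + C1) * E i) <= c * (4 + C1) * S.
  by rewrite mulrA ler_wpM2l // mulr_ge0 //; lra.
have S0 : 0 <= S by rewrite sumr_ge0.
have h' : C1 * S <= c * (4 + C1) * S.
  rewrite ler_wpM2r //; have := ler_wpM2r (_ : 0 <= 4 + C1) c1; rewrite mul1r.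
  by move=> /(_ _) h2; apply: le_trans (h2 _); lra.
lra.
Qed.

(* [27 = 3 * 3 * 3]: range of the coupling, multiplicity of a site among the
   neighbourhoods of the sites of a cube, volume ratio of consecutive cubes. *)
Definition speed C1 (lam : R) : R := K * 27 ^+ d * (4 + C1) / lam.

Section Gronwall.
Variables (V G : site d -> R -> R) (C1 lam : R).
Hypotheses (K0 : 0 <= K) (C10 : 0 <= C1) (lam0 : 0 < lam).
Hypothesis V0 : forall j q, 0 <= V j q.
Hypothesis Vq : forall j q, lam ^+ 2 * q ^+ 2 <= C1 * (V j q + 1 + lam ^+ 4).
Hypothesis VG : forall i (q : R), is_derive q 1 (V i) (G i q).

Lemma hsite_ge1 x i : 1 <= hsite V x i.
Proof. by rewrite /hsite; have := sqr_ge0 (x i).2; have := V0 i (x i).1; lra. Qed.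

Lemma avg_energy_ge0 nu k x : 0 <= avg_energy V lam nu k x.
Proof.
rewrite divr_ge0 ?exprn_ge0 // sumr_ge0 // => o _.
by rewrite addr_ge0 ?exprn_ge0 ?(ltW lam0) // (le_trans _ (hsite_ge1 _ _)).
Qed.

Lemma speed_ge0 : 0 <= speed C1 lam.
Proof. by rewrite divr_ge0 ?(ltW lam0) // !mulr_ge0 ?exprn_ge0 ?addr_ge0. Qed.

Lemma avg_energy_der y (t : R) nu k : gsolves_at G y t ->
  exists2 D, is_derive t 1 (fun s => avg_energy V lam nu k (y s)) D &
    `|D| <= speed C1 lam * avg_energy V lam nu k.+1 (y t).
Proof.
move=> sol.
pose dE i : R := - (K * ((y t i).2 * coupling (y t) i)).
exists ((k.*2.+1)%:R ^- d * \sum_(o : {ffun 'I_d -> 'I_(k.*2.+1)}) dE (cube_pt nu k o)).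
  have := @pder_sum R t {ffun 'I_d -> 'I_(k.*2.+1)}
    (fun o s => hsite V (y s) (cube_pt nu k o) + lam ^+ 4) (fun o => dE (cube_pt nu k o)).
  move=> /(_ _)/(pderZ ((k.*2.+1)%:R ^- d)) h.
  rewrite (_ : (fun s => _) = (fun s => (k.*2.+1)%:R ^- d *
    \sum_(o : {ffun 'I_d -> 'I_(k.*2.+1)}) (hsite V (y s) (cube_pt nu k o) + lam ^+ 4))).
    apply: h => o; rewrite -[dE _]addr0; apply: pderD (pderC _ _).
    exact: hsite_der sol.
  by apply/funext => s; rewrite mulrC.
pose E j := hsite V (y t) j + lam ^+ 4.
have E0 j : 0 <= E j.
  by rewrite addr_ge0 ?exprn_ge0 ?(ltW lam0) // (le_trans _ (hsite_ge1 _ _)).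
rewrite normrM ger0_norm ?invr_ge0 ?exprn_ge0 //.
set c := K * 3 ^+ d * (4 + C1) / lam.
have c0 : 0 <= c by rewrite divr_ge0 ?(ltW lam0) // !mulr_ge0 ?exprn_ge0 ?addr_ge0.
have h : `|\sum_(o : {ffun 'I_d -> 'I_(k.*2.+1)}) dE (cube_pt nu k o)| <=
  c * (3 ^+ d * \sum_(o : {ffun 'I_d -> 'I_(k.+1.*2.+1)}) E (cube_pt nu k.+1 o)).
  apply: (le_trans (ler_norm_sum _ _ _)).
  apply: le_trans (ler_wpM2l c0 (sum_cube_nbr_le nu k E0)).
  rewrite mulr_sumr; apply: ler_sum => o _; rewrite normrN.
  exact: coupling_power_le.
have n0 := cube_size_gt0 R d k.
have n1 := cube_size_gt0 R d k.+1.
rewrite /speed /avg_energy -/E.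
rewrite mulrC ler_pdivrMr //; apply: (le_trans h).
set S := \sum_(o : {ffun 'I_d -> 'I_(k.+1.*2.+1)}) E _.
have S0 : 0 <= S by rewrite sumr_ge0.
have -> : 27 ^+ d = 3 ^+ d * (3 ^+ d * 3 ^+ d) :> R by rewrite -!exprMn; congr (_ ^+ _); ring.
have -> : K * (3 ^+ d * (3 ^+ d * 3 ^+ d)) * (4 + C1) / lam * (S / (k.+1.*2.+1)%:R ^+ d) *
    (k.*2.+1)%:R ^+ d = c * 3 ^+ d * S * (3 ^+ d * (k.*2.+1)%:R ^+ d / (k.+1.*2.+1)%:R ^+ d).
  by rewrite /c; field; rewrite !lt0r_neq0.
rewrite mulrA; apply: ler_peMr.
  by apply: mulr_ge0 S0; apply: mulr_ge0 c0 _; exact: exprn_ge0.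
by rewrite ler_pdivlMr // mul1r cube_size_next.
Qed.

(** The sign [e] and base time [t0] give the forward and the backward estimate at once; radii start
    at [k0], so that admissibility of [k0] suffices. *)
Lemma energy_gronwall y (t0 e T N B D : R) nu k0 :
  `|e| = 1 -> 0 <= T -> 0 <= N -> 0 <= B ->
  (forall s, 0 <= s <= T -> gsolves_at G y (t0 + e * s)) ->
  (forall k s, 0 <= s <= T ->
     avg_energy V lam nu (k0 + k)%N (y (t0 + e * s)) <= B * expR (D * k%:R)) ->
  (forall k, avg_energy V lam nu (k0 + k)%N (y t0) <= N) ->
  forall k, avg_energy V lam nu (k0 + k)%N (y (t0 + e * T)) <= N * expR (speed C1 lam * T).
Proof.
move=> e1 T0 N0 B0 sol apr init k.
(* The equations are known only for s in [0, T]; elsewhere the derivative gets the default 0. *)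
pose ex k s := (if pselect (gsolves_at G y (t0 + e * s)) is left h then
  s2val (cid2 (avg_energy_der nu k h)) else 0) : R.
have exP k' s : 0 <= s <= T ->
    is_derive (t0 + e * s) 1 (fun r => avg_energy V lam nu k' (y r)) (ex k' s) /\
    `|ex k' s| <= speed C1 lam * avg_energy V lam nu k'.+1 (y (t0 + e * s)).
  move=> sT; rewrite /ex; case: pselect => [h|/(_ (sol _ sT))//].
  by case: cid2.
apply: (@gronwall_chain R T (speed C1 lam) N B D
  (fun k s => avg_energy V lam nu (k0 + k)%N (y (t0 + e * s))) (fun k s => e * ex (k0 + k)%N s)) => //.
- exact: speed_ge0.
- move=> k' s sT; apply: (is_derive_aff (f := fun r => avg_energy V lam nu (k0 + k') (y r))).
  by case: (exP (k0 + k')%N s sT).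
- by move=> k' s sT; rewrite normrM e1 mul1r addnS; case: (exP (k0 + k')%N s sT).
- by move=> *; exact: avg_energy_ge0.
- by move=> k'; rewrite mulr0 addr0.
- by rewrite T0 lexx.
Qed.

End Gronwall.
End Energy.

(** * Quartic polynomials *)

Section Quartic.
Variable R : realType.
Implicit Types (U : {poly R}).

Lemma horner_quartic U (q : R) : size U = 5%N ->
  U.[q] = U`_0 + U`_1 * q + U`_2 * q ^+ 2 + U`_3 * q ^+ 3 + U`_4 * q ^+ 4.
Proof.
move=> sU; rewrite horner_coef sU !big_ord_recl big_ord0 /= /bump /=.
by rewrite addr0 expr0 mulr1 expr1 !addrA.
Qed.

Lemma horner_deriv_quartic U (q : R) : size U = 5%N ->
  U^`().[q] = U`_1 + 2 * U`_2 * q + 3 * U`_3 * q ^+ 2 + 4 * U`_4 * q ^+ 3.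
Proof.
move=> sU; rewrite (@horner_coef_wide _ 4); last first.
  by have := lt_size_deriv (_ : U != 0); rewrite sU ltnS; apply; rewrite -size_poly_eq0 sU.
rewrite !big_ord_recl big_ord0 /= /bump /= !coef_deriv.
by rewrite addr0 expr0 mulr1 expr1 !addrA !mulr_natl.
Qed.

Lemma abs_le_sqr (x : R) : `|x| <= (1 + x ^+ 2) / 2.
Proof.
rewrite -(real_normK (num_real x)); have := sqr_ge0 (`|x| - 1); rewrite !expr2; lra.
Qed.

(** Once a q^4 is moved to the right, a q^4 remains there. A quarter of it absorbs the cubic term by
    completing a square, three quarters absorb m q^2. In m, 2|c| covers the quadratic term, 4 b^2 /
    a the price of the first square, and 1 the q^2 in (q + e)^2. *)
Lemma quartic_coercive (a b c e f q : R) : 0 < a ->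
  a * q ^+ 4 <= 2 * (f + e * q + c * q ^+ 2 + b * q ^+ 3 + a * q ^+ 4)
    + ((2 * `|c| + 4 * b ^+ 2 / a + 1) ^+ 2 / (3 * a) + e ^+ 2 + 2 * `|f|).
Proof.
move=> a0; set m := 2 * `|c| + _ + 1.
have h1 : 0 <= (a / 4 * q ^+ 2 + 2 * b * q + 4 * b ^+ 2 / a) * q ^+ 2.
  apply: mulr_ge0 (sqr_ge0 _).
  have -> : a / 4 * q ^+ 2 + 2 * b * q + 4 * b ^+ 2 / a = (a * q / 2 + 2 * b) ^+ 2 / a.
    by field; rewrite lt0r_neq0.
  by rewrite divr_ge0 ?sqr_ge0 // ltW.
have h2 : 0 <= 3 * a / 4 * q ^+ 4 - m * q ^+ 2 + m ^+ 2 / (3 * a).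
  have -> : 3 * a / 4 * q ^+ 4 - m * q ^+ 2 + m ^+ 2 / (3 * a) =
     3 * a / 4 * (q ^+ 2 - 2 * m / (3 * a)) ^+ 2 by field; rewrite lt0r_neq0.
  by rewrite mulr_ge0 ?sqr_ge0 // divr_ge0 // mulr_ge0 // ltW.
have h3 : 0 <= (`|c| + c) * q ^+ 2.
  by apply: mulr_ge0 (sqr_ge0 _); have := ler_norm (- c); rewrite normrN; lra.
have h4 := sqr_ge0 (q + e).
have h5 : 0 <= f + `|f| by have := ler_norm (- f); rewrite normrN; lra.
have -> : q ^+ 4 = q ^+ 2 * q ^+ 2 by ring.
have -> : q ^+ 3 = q ^+ 2 * q by ring.
have e4 : q ^+ 4 = q ^+ 2 * q ^+ 2 by ring.
rewrite e4 in h2.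
have em : m * q ^+ 2 = (2 * `|c| + 4 * b ^+ 2 / a + 1) * q ^+ 2 by [].
rewrite em in h2.
set u := m ^+ 2 / (3 * a) in h2 *.
move: h1 h2 h3 h4; rewrite !expr2.
set v := 4 * _ / a.
lra.
Qed.

Lemma quartic_bounds U : size U = 5%N -> 0 < lead_coef U -> (forall r, 0 <= U.[r]) ->
  exists (C : R) (U2 : R -> R), [/\ 1 <= C,
    (forall q, q ^+ 4 <= C * (U.[q] + 1)),
    (forall q r, `|U^`().[q] - U^`().[r]| <= C * (1 + q ^+ 2 + r ^+ 2) * `|q - r|),
    (forall q r, `|U^`().[q] - U^`().[r] - U2 r * (q - r)| <=
        C * (1 + q ^+ 2 + r ^+ 2) * (q - r) ^+ 2) &
    [/\ (forall q, `|U2 q| <= C * (1 + q ^+ 2)), continuous U2 &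
    (forall q, C <= `|q| -> 0 <= U^`().[q] * q)]].
Proof.
move=> sU lU U0.
have UE := horner_quartic _ sU; have U'E := horner_deriv_quartic _ sU.
move: lU; rewrite lead_coefE sU /=.
set a := U`_4 in UE U'E *; set b := U`_3 in UE U'E *; set c := U`_2 in UE U'E *.
set e := U`_1 in UE U'E *; set f := U`_0 in UE U'E *.
move: a b c e f UE U'E => a b c e f UE U'E a0.
set M := (2 * `|c| + 4 * b ^+ 2 / a + 1) ^+ 2 / (3 * a) + e ^+ 2 + 2 * `|f|.
have M0 : 0 <= M.
  apply: addr_ge0; last by rewrite mulr_ge0.
  apply: addr_ge0 (sqr_ge0 _); apply: divr_ge0 (sqr_ge0 _) _.
  by rewrite mulr_ge0 // ltW.
have b0 := normr_ge0 b; have c0 := normr_ge0 c; have e0 := normr_ge0 e.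
pose s := 3 * `|b| + 2 * `|c| + `|e|.
have s0 : 0 <= s by rewrite /s; lra.
have s4 : 0 <= s / (4 * a) by rewrite divr_ge0 // mulr_ge0 // ltW.
have M2 : 0 <= (2 + M) / a by rewrite divr_ge0 ?(ltW a0) //; lra.
(* The summands serve in turn: |q| >= 1 far out, coercivity, the Lipschitz and Taylor bounds, and
   the dominance of 4 a |q| over the lower coefficients of U' for |q| >= C. [U2] is the second
   derivative. *)
pose C := 1 + (2 + M) / a + (2 * `|c| + 6 * `|b| + 12 * a) + s / (4 * a).
pose U2 r := 2 * c + 6 * b * r + 12 * a * r ^+ 2.
have C_ge x : 0 <= x -> (2 * `|c| + 6 * `|b| + 12 * a) * x <= C * x.
  by move=> x0; apply: ler_wpM2r => //; rewrite /C; lra.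
exists C, U2; split; first by rewrite /C; lra.
- move=> q; have := quartic_coercive b c e f q a0; rewrite -/M -UE => h.
  have u0 := U0 q.
  have : q ^+ 4 <= (2 + M) / a * (U.[q] + 1).
    rewrite mulrAC ler_pdivlMr // mulrC; apply: (le_trans h).
    by have := mulr_ge0 M0 u0; lra.
  move=> /le_trans; apply; apply: ler_wpM2r; first lra.
  by rewrite /C; lra.
- move=> q r; rewrite !U'E.
  have -> : e + 2 * c * q + 3 * b * q ^+ 2 + 4 * a * q ^+ 3 -
      (e + 2 * c * r + 3 * b * r ^+ 2 + 4 * a * r ^+ 3) =
      (2 * c + 3 * b * (q + r) + 4 * a * (q ^+ 2 + q * r + r ^+ 2)) * (q - r) by ring.
  rewrite normrM ler_wpM2r //.
  have x0 : 0 <= 1 + q ^+ 2 + r ^+ 2 by rewrite !addr_ge0 ?sqr_ge0.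
  apply: le_trans (C_ge _ x0).
  have hq := abs_le_sqr q; have hr := abs_le_sqr r.
  have n1 : `|q + r| <= 1 + q ^+ 2 + r ^+ 2.
    by have := ler_normD q r; have := sqr_ge0 q; have := sqr_ge0 r; lra.
  have n2 : `|q ^+ 2 + q * r + r ^+ 2| <= 2 * (1 + q ^+ 2 + r ^+ 2).
    rewrite ler_norml; apply/andP.
    have := sqr_ge0 q; have := sqr_ge0 r; have := sqr_ge0 (q + r); have := sqr_ge0 (q - r).
    by rewrite !expr2; split; lra.
  have t1 : `|2 * c| = 2 * `|c| by rewrite normrM ger0_norm.
  have t2 : `|3 * b * (q + r)| <= 3 * `|b| * (1 + q ^+ 2 + r ^+ 2).
    by rewrite !normrM (ger0_norm (_ : 0 <= 3)) // ler_wpM2l // mulr_ge0.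
  have t3 : `|4 * a * (q ^+ 2 + q * r + r ^+ 2)| <= 4 * a * (2 * (1 + q ^+ 2 + r ^+ 2)).
    by rewrite normrM ger0_norm ?mulr_ge0 ?(ltW a0) // ler_wpM2l // mulr_ge0 // ltW.
  have := ler_normD (2 * c + 3 * b * (q + r)) (4 * a * (q ^+ 2 + q * r + r ^+ 2)).
  have := ler_normD (2 * c) (3 * b * (q + r)).
  have y0 : 0 <= q ^+ 2 + r ^+ 2 by rewrite !addr_ge0 ?sqr_ge0.
  have := mulr_ge0 c0 y0; have := mulr_ge0 b0 x0; have := mulr_ge0 (ltW a0) x0.
  move: t1 t2 t3; set X := 1 + _ + _; have -> : q ^+ 2 + r ^+ 2 = X - 1 by rewrite /X; ring.
  by lra.
- move=> q r; rewrite !U'E /U2.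
  have -> : e + 2 * c * q + 3 * b * q ^+ 2 + 4 * a * q ^+ 3 -
      (e + 2 * c * r + 3 * b * r ^+ 2 + 4 * a * r ^+ 3) -
      (2 * c + 6 * b * r + 12 * a * r ^+ 2) * (q - r) =
      (3 * b + 4 * a * (q + 2 * r)) * (q - r) ^+ 2 by ring.
  rewrite normrM (ger0_norm (sqr_ge0 _)) ler_wpM2r ?sqr_ge0 //.
  have x0 : 0 <= 1 + q ^+ 2 + r ^+ 2 by rewrite !addr_ge0 ?sqr_ge0.
  apply: le_trans (C_ge _ x0).
  have hq := abs_le_sqr q; have hr := abs_le_sqr r.
  have n1 : `|q + 2 * r| <= 2 * (1 + q ^+ 2 + r ^+ 2).
    have := ler_normD q (2 * r); rewrite normrM (ger0_norm (_ : 0 <= 2)) //.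
    by have := sqr_ge0 q; have := sqr_ge0 r; lra.
  have t1 : `|3 * b| = 3 * `|b| by rewrite normrM ger0_norm.
  have t3 : `|4 * a * (q + 2 * r)| <= 4 * a * (2 * (1 + q ^+ 2 + r ^+ 2)).
    by rewrite normrM ger0_norm ?mulr_ge0 ?(ltW a0) // ler_wpM2l // mulr_ge0 // ltW.
  have := ler_normD (3 * b) (4 * a * (q + 2 * r)).
  have y0 : 0 <= q ^+ 2 + r ^+ 2 by rewrite !addr_ge0 ?sqr_ge0.
  have := mulr_ge0 c0 x0; have := mulr_ge0 b0 y0; have := mulr_ge0 b0 x0.
  have := mulr_ge0 (ltW a0) x0.
  move: t1 t3; set X := 1 + _ + _; have -> : q ^+ 2 + r ^+ 2 = X - 1 by rewrite /X; ring.
  by lra.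
split.
- move=> q; rewrite /U2.
  have x0 : 0 <= 1 + q ^+ 2 by rewrite !addr_ge0 ?sqr_ge0.
  apply: le_trans (C_ge _ x0).
  have hq := abs_le_sqr q.
  have t1 : `|2 * c| = 2 * `|c| by rewrite normrM ger0_norm.
  have t2 : `|6 * b * q| <= 6 * `|b| * (1 + q ^+ 2).
    rewrite !normrM (ger0_norm (_ : 0 <= 6)) // ler_wpM2l // ?mulr_ge0 //.
    by have := sqr_ge0 q; lra.
  have t3 : `|12 * a * q ^+ 2| = 12 * a * q ^+ 2.
    by rewrite ger0_norm //; apply: mulr_ge0 (sqr_ge0 _); rewrite mulr_ge0 // ltW.
  have := ler_normD (2 * c + 6 * b * q) (12 * a * q ^+ 2).
  have := ler_normD (2 * c) (6 * b * q).
  have := mulr_ge0 c0 (sqr_ge0 q).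
  by lra.
- move=> q; apply: (@is_derive_cont _ _ _ (6 * b * 1 + 12 * a * (q * 1 + q * 1))).
  have h := pderD (pderC q (2 * c)) (pderZ (6 * b) (pder_id q)).
  have := pderD h (pderZ (12 * a) (pderM (pder_id q) (pder_id q))).
  by rewrite add0r.
- move=> q Cq; rewrite U'E.
  have Cq1 : 1 <= `|q| by apply: le_trans Cq; rewrite /C; lra.
  have Cqs : s <= 4 * a * `|q|.
    rewrite mulrC -ler_pdivrMr ?mulr_gt0 //; apply: le_trans Cq; rewrite /C; lra.
  have q2 : `|q| ^+ 2 = q ^+ 2 by rewrite real_normK // num_real.
  have q4 : q ^+ 4 = `|q| ^+ 3 * `|q| by rewrite -exprSr -normrX ger0_norm // exprn_even_ge0.
  have -> : (e + 2 * c * q + 3 * b * q ^+ 2 + 4 * a * q ^+ 3) * q =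
     e * q + 2 * c * q ^+ 2 + 3 * b * q ^+ 3 + 4 * a * q ^+ 4 by ring.
  have k1 : - (`|e| * `|q| ^+ 3) <= e * q.
    have : `|e * q| <= `|e| * `|q| ^+ 3.
      by rewrite normrM ler_wpM2l // ler_eXnr.
    by rewrite ler_norml => /andP[].
  have k2 : - (2 * `|c| * `|q| ^+ 3) <= 2 * c * q ^+ 2.
    have : `|2 * c * q ^+ 2| <= 2 * `|c| * `|q| ^+ 3.
      rewrite 2!normrM (ger0_norm (_ : 0 <= 2)) // normrX ler_wpM2l ?mulr_ge0 //.
      by rewrite ler_weXn2l.
    by rewrite ler_norml => /andP[].
  have k3 : - (3 * `|b| * `|q| ^+ 3) <= 3 * b * q ^+ 3.
    have : `|3 * b * q ^+ 3| <= 3 * `|b| * `|q| ^+ 3.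
      by rewrite 2!normrM (ger0_norm (_ : 0 <= 3)) // normrX.
    by rewrite ler_norml => /andP[].
  have := ler_wpM2l (exprn_ge0 3 (normr_ge0 q)) Cqs.
  rewrite q4 /s; lra.
Qed.

End Quartic.

(** * Superstability *)

Section Superstable.
Variables (R : realType) (d : nat).
Implicit Types (V : site d -> R -> R) (x : state R d) (nu i : site d).

Definition ell i : R := ln (expR 1 + (lnorm i)%:R).

Definition adm nu (k : nat) : Prop := powR (ell nu) (d%:R)^-1 < k%:R.

(** A real-valued substitute for [Qfun] without the interaction energy, usable for any on-site
    potentials. For [U] the two agree up to the factor [cW], by [Qfun_le] and [bnd_Qfun]. *)
Definition bnd V x (N : R) := forall nu k, adm nu k ->
  \sum_(o : {ffun 'I_d -> 'I_(k.*2.+1)}) hsite V x (cube_pt nu k o) <= N * (k.*2.+1)%:R ^+ d.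

Lemma ell_site_ge1 i : 1 <= ell i.
Proof. exact: ell_ge1. Qed.

Lemma adm_le nu k k' : (k <= k')%N -> adm nu k -> adm nu k'.
Proof. by move=> kk h; apply: (lt_le_trans h); rewrite ler_nat. Qed.

(** With p = (ell nu)^(1/d) >= 1, the integer k just above p has 2k + 1 <= 2p + 3 <= 5p. *)
Lemma adm_ex nu : (0 < d)%N ->
  exists2 k, adm nu k & (k.*2.+1)%:R ^+ d <= 5 ^+ d * ell nu.
Proof.
move=> d0; set p := powR (ell nu) (d%:R)^-1.
have l1 := ell_site_ge1 nu.
have p1 : 1 <= p.
  by rewrite -(powRr0 (ell nu)) /p ler_powR // invr_ge0.
have pd : p ^+ d = ell nu.
  rewrite -powR_mulrn ?(le_trans _ p1) // /p -powRrM mulVf ?pnatr_eq0 -?lt0n //.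
  by rewrite powRr1 // (le_trans _ l1).
have p0 : 0 <= p by exact: le_trans p1.
exists (Num.truncn p).+1; first by rewrite /adm -/p truncnS_gt.
rewrite -pd -exprMn lerXn2r ?nnegrE ?mulr_ge0 //.
have /andP[h _] := truncn_itv p0.
rewrite -addnn -natr1 natrD -natr1; lra.
Qed.

Lemma bnd_ge1 V x N : (0 < d)%N -> (forall j q, 0 <= V j q) -> bnd V x N -> 1 <= N.
Proof.
move=> d0 V0 h; have [k kadm _] := adm_ex ([ffun=> 0] : site d) d0.
have := h _ _ kadm; rewrite -ler_pdivrMr ?cube_size_gt0 //; apply: le_trans.
rewrite ler_pdivlMr ?cube_size_gt0 // mul1r -natrX -card_cube -sumr_const.
by apply: ler_sum => o _; exact: hsite_ge1.
Qed.

(** All site energies are nonnegative, so one term is at most the sum over a smallest admissible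
    cube centred at i, whose volume is of order [ell i]. This is the source of the logarithm. *)
Lemma bnd_site V x N i : (0 < d)%N -> (forall j q, 0 <= V j q) -> bnd V x N ->
  hsite V x i <= 5 ^+ d * N * ell i.
Proof.
move=> d0 V0 h; have N1 := bnd_ge1 d0 V0 h.
have [k kadm ksz] := adm_ex i d0.
have := h _ _ kadm; rewrite (bigD1 (cube_center d k)) //= cube_pt_center => h1.
apply: le_trans (_ : N * (k.*2.+1)%:R ^+ d <= _).
  apply: le_trans h1; rewrite lerDl sumr_ge0 // => o _.
  exact: le_trans (hsite_ge1 V0 _ _).
rewrite (mulrC (5 ^+ d)) -mulrA ler_wpM2l //; exact: le_trans N1.
Qed.

Lemma avg_energyE V lam nu k x : avg_energy V lam nu k x =
  (\sum_(o : {ffun 'I_d -> 'I_(k.*2.+1)}) hsite V x (cube_pt nu k o)) / (k.*2.+1)%:R ^+ d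
  + lam ^+ 4.
Proof.
rewrite /avg_energy big_split /= sumr_const card_cube -[(lam ^+ 4) *+ _]mulr_natl natrX mulrDl.
by congr (_ + _); rewrite mulrAC mulfV ?mul1r // lt0r_neq0 // cube_size_gt0.
Qed.

Lemma avg_energy_le V lam nu k x N : bnd V x N -> adm nu k ->
  avg_energy V lam nu k x <= N + lam ^+ 4.
Proof.
by move=> h kadm; rewrite avg_energyE lerD2r ler_pdivrMr ?cube_size_gt0 //; exact: h.
Qed.

Lemma bnd_of_avg_energy V lam x N :
  (forall nu k, adm nu k -> avg_energy V lam nu k x <= N) -> bnd V x N.
Proof.
move=> h nu k kadm; rewrite -ler_pdivrMr ?cube_size_gt0 //.
by apply: le_trans (h _ _ kadm); rewrite avg_energyE lerDl exprn_even_ge0.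
Qed.

Section SupremumBounds.
Variables (U : {poly R}) (K C1 : R).
Hypotheses (d0 : (0 < d)%N) (K0 : 0 < K) (C11 : 1 <= C1).
Hypothesis U0 : forall q, 0 <= U.[q].
Hypothesis Uq : forall q, q ^+ 4 <= C1 * (U.[q] + 1).

Let UV : site d -> R -> R := fun _ q => U.[q].

Lemma sqr_le_hsite x i : (x i).1 ^+ 2 <= 2 * C1 * hsite UV x i.
Proof.
have u0 := U0 (x i).1; have := Uq (x i).1; rewrite /hsite /UV; have C11' := C11.
have p0 := sqr_ge0 (x i).2; set h := U.[_] in u0 *.
have := sqr_ge0 ((x i).1 ^+ 2 - 1).
have : C1 * h + C1 <= C1 * ((x i).2 ^+ 2 / 2 + h + 1).
  have := ler_wpM2l (_ : 0 <= C1) (_ : h + 1 <= (x i).2 ^+ 2 / 2 + h + 1); lra.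
have : 1 <= C1 * ((x i).2 ^+ 2 / 2 + h + 1).
  have := @ler_pM _ 1 C1 1 ((x i).2 ^+ 2 / 2 + h + 1); lra.
have -> : (x i).1 ^+ 4 = (x i).1 ^+ 2 * (x i).1 ^+ 2 by ring.
rewrite [_ ^+ 2]expr2; lra.
Qed.

(** Use (u - v)^2 <= 2 u^2 + 2 v^2, at most 3^d partners per site, and q^2 bounded by the site
    energy thanks to quartic growth. *)
Lemma Wloc_le nu k x : Wloc U K nu k x <=
  (1 + K * 3 ^+ d * (2 * C1)) *
  \sum_(o : {ffun 'I_d -> 'I_(k.*2.+1)}) hsite UV x (cube_pt nu k o).
Proof.
rewrite /Wloc mulrDl mul1r lerD2l.
pose f (o : {ffun 'I_d -> 'I_(k.*2.+1)}) := (x (cube_pt nu k o)).1 ^+ 2.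
pose near (o1 o2 : {ffun 'I_d -> 'I_(k.*2.+1)}) :=
  ldist (cube_pt nu k o2) (cube_pt nu k o1) == 1%N.
have f0 o : 0 <= f o by exact: sqr_ge0.
have K0' := K0.
apply: le_trans (_ : K / 2 * (\sum_o1 \sum_o2 (if near o1 o2 then f o1 else 0) +
                   \sum_o1 \sum_o2 (if near o1 o2 then f o2 else 0)) <= _).
  rewrite -big_split mulr_sumr /=; apply: ler_sum => o1 _.
  rewrite -big_split mulr_sumr /=; apply: ler_sum => o2 _; rewrite -/(near o1 o2).
  case: ifP => _; last by rewrite addr0 mulr0.
  rewrite /f; set u := (x _).1; set v := (x _).1.
  have := mulr_ge0 (ltW K0') (sqr_ge0 (u + v)); rewrite !expr2; lra.
rewrite [X in _ + X]exchange_big /=.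
have -> : \sum_o2 \sum_o1 (if near o1 o2 then f o2 else 0) =
          \sum_o1 \sum_o2 (if near o1 o2 then f o1 else 0).
  by apply: eq_bigr => o1 _; apply: eq_bigr => o2 _; rewrite /near ldistC.
have h := sum_nbr_pairs_le nu f0.
have h2 : \sum_o f o <= 2 * C1 * \sum_(o : {ffun 'I_d -> 'I_(k.*2.+1)}) hsite UV x (cube_pt nu k o).
  by rewrite mulr_sumr; apply: ler_sum => o _; exact: sqr_le_hsite.
have -> : forall y, K / 2 * (y + y) = K * y by move=> y; field.
rewrite -!mulrA; apply: ler_wpM2l; first exact: ltW.
by apply: (le_trans h); apply: ler_wpM2l; [exact: exprn_ge0|rewrite mulrA].
Qed.

Lemma Wloc_ge nu k x :
  \sum_(o : {ffun 'I_d -> 'I_(k.*2.+1)}) hsite UV x (cube_pt nu k o) <= Wloc U K nu k x.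
Proof.
rewrite /Wloc lerDl; apply: sumr_ge0 => o1 _; apply: sumr_ge0 => o2 _.
case: ifP => // _; apply: mulr_ge0 (sqr_ge0 _); rewrite divr_ge0 //; exact: ltW.
Qed.

Definition cW : R := 1 + K * 3 ^+ d * (2 * C1).

Lemma Qfun_le x N : bnd UV x N -> (Qfun U K x <= (cW * N)%:E)%E.
Proof.
move=> h; apply: ge_ereal_sup => _ [nu [k [kadm ->]]].
rewrite lee_fin ler_pdivrMr ?cube_size_gt0 // -mulrA.
apply: (le_trans (Wloc_le nu k x)); apply: ler_wpM2l; last exact: h.
by rewrite addr_ge0 // !mulr_ge0 ?exprn_ge0 ?(ltW K0) // (le_trans _ C11).
Qed.

Lemma bnd_Qfun x N : (Qfun U K x <= N%:E)%E -> bnd UV x N.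
Proof.
move=> h nu k kadm; apply: (le_trans (Wloc_ge nu k x)).
rewrite -ler_pdivrMr ?cube_size_gt0 // -lee_fin; apply: le_trans h.
by apply: ereal_sup_ubound; exists nu, k.
Qed.

Lemma X0_bnd x : X0 U K x <-> exists N, bnd UV x N.
Proof.
split=> [h|[N h]]; last by apply: le_lt_trans (Qfun_le h) (ltry _).
case E : (Qfun U K x) h => [N| |] h.
- by exists N; apply: bnd_Qfun; rewrite E.
- by move: h; rewrite /X0 /= E.
- exists 0; apply: bnd_Qfun; rewrite E; exact: leNye.
Qed.

Lemma X0_Qfun x : X0 U K x -> Qfun U K x = (fine (Qfun U K x))%:E /\ 1 <= fine (Qfun U K x).
Proof.
move=> xX; case E : (Qfun U K x) => [N| |] /=.
- have : bnd UV x N by apply: bnd_Qfun; rewrite E.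
  by move/(bnd_ge1 d0 (fun _ => U0)).
- by move: xX; rewrite /X0 /= E.
- have : bnd UV x 0 by apply: bnd_Qfun; rewrite E; exact: leNye.
  by move/(bnd_ge1 d0 (fun _ => U0)); rewrite ler10.
Qed.

End SupremumBounds.
End Superstable.

(** * Dynamics with Lipschitz forces *)

Section LatticeFlow.
Variables (R : realType) (d : nat) (K : R).
Hypothesis K0 : 0 <= K.
Implicit Types (x : state R d) (i j : site d).

Definition comp x i (b : bool) : R := if b then (x i).2 else (x i).1.

Definition swt (a c : R) i : R -> R := wt a c (lnorm i)%:R.
Definition dswt (a c : R) i : R -> R := dwt a c (lnorm i)%:R.

(* The growth rate of the weights that makes the vector field a contraction. *)
Definition rate (M : R) : R := 2 * (M + 1 + K * 3 ^+ d * (1 + expR 1)).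

Lemma coupling_eq x x' i : (forall j, (x j).1 = (x' j).1) -> coupling x i = coupling x' i.
Proof. by move=> h; apply: eq_bigr => o _; rewrite !h. Qed.

Lemma couplingB x x' i :
  coupling x i - coupling x' i = coupling (fun j => ((x j).1 - (x' j).1, 0)) i.
Proof.
rewrite /coupling -sumrB; apply: eq_bigr => o _ /=.
by case: ifP => _; [ring|rewrite subrr].
Qed.

Lemma coupling_le (a c b t : R) x i : 1 <= a -> 0 <= c -> 0 <= b -> 0 <= t ->
  (forall j, `|(x j).1| <= b * swt a c j t) ->
  `|coupling x i| <= 3 ^+ d * (1 + expR 1) * (b * swt a c i t).
Proof.
move=> a1 c0 b0 t0 h.
have w0 : 0 <= swt a c i t by exact: wt_ge0.
have e0 : 0 <= 1 + expR 1 :> R by rewrite addr_ge0 // expR_ge0.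
apply: (le_trans (ler_norm_sum _ _ _)).
apply: le_trans (_ : \sum_(o : {ffun 'I_d -> 'I_(1%N.*2.+1)}) (1 + expR 1) * (b * swt a c i t) <= _).
  apply: ler_sum => o _; case: ifP => [/eqP ho|_]; last by rewrite normr0 !mulr_ge0.
  apply: (le_trans (ler_normB _ _)); rewrite mulrDl mul1r; apply: lerD; first exact: h.
  apply: (le_trans (h _)); rewrite mulrCA ler_wpM2l //.
  apply: wt_next => //.
  by rewrite natr1 ler_nat; have := lnorm_ldist i (cube_pt i 1 o); rewrite ho addn1.
by rewrite sumr_const card_cube -[(_ * _) *+ _]mulr_natl natrX mulrA.
Qed.

Lemma rate_ge (M : R) : 0 <= M -> 2 <= rate M.
Proof.
move=> M0; have : 0 <= K * 3 ^+ d * (1 + expR 1).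
  by rewrite !mulr_ge0 // ?exprn_ge0 // addr_ge0 // expR_ge0.
by rewrite /rate; lra.
Qed.

Lemma swt_bounds (a c : R) i (t : R) : 1 <= a -> 0 <= c -> 0 <= t ->
  [/\ 1 <= ell R i, 1 <= swt a c i t, ell R i <= swt a c i t &
      c * ell R i * swt a c i t <= dswt a c i t].
Proof.
move=> a1 c0 t0; split; [exact: ell_site_ge1|exact: wt_ge1|exact: ell_le_wt|exact: dwt_ge].
Qed.

(** The gain [c * ell * swt] in [dswt] pays for everything: in [rate], M stands for the force, 1 for
    the equation q' = p, and the last term for the coupling, where a neighbour's weight costs a
    factor e. By linearity of the coupling it applies to differences of states, and [e] leaves room
    for an inhomogeneity. *)
Lemma field_bound (M a c b e t : R) x i (Di : R) : 0 <= M -> 1 <= a -> rate M <= c ->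
  0 <= b -> 0 <= t ->
  (forall j bb, `|comp x j bb| <= b * swt a c j t) ->
  `|Di| <= M * ell R i * (b * swt a c i t) + e * dswt a c i t -> 0 <= e ->
  forall bb : bool, `|if bb then - Di - K * coupling x i else (x i).2| <=
     (b / 2 + e) * dswt a c i t.
Proof.
move=> M0 a1 cr b0 t0 hx hD e0 bb.
have c0 : 0 <= c by have := rate_ge M0; lra.
have [l1 w1 _ dw] := swt_bounds i a1 c0 t0.
have b20 : 0 <= b / 2 by rewrite divr_ge0.
have bw0 : 0 <= b * swt a c i t by rewrite mulr_ge0 // (le_trans _ w1).
have lw : b * swt a c i t <= ell R i * (b * swt a c i t).
  by rewrite ler_peMl.
have L0 : 0 <= ell R i * (b * swt a c i t) by exact: le_trans lw.
have dw0 : 0 <= dswt a c i t by exact: dwt_ge0.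
have main : (M + 1 + K * 3 ^+ d * (1 + expR 1)) * (ell R i * (b * swt a c i t)) <=
    b / 2 * dswt a c i t.
  have h1 := ler_wpM2l b20 dw.
  apply: le_trans h1.
  have -> : b / 2 * (c * ell R i * swt a c i t) = c / 2 * (ell R i * (b * swt a c i t)) by ring.
  by apply: ler_wpM2r => //; move: cr; rewrite /rate; lra.
have ed := mulr_ge0 e0 dw0.
set k := K * 3 ^+ d * (1 + expR 1) in main *.
have k0 : 0 <= k by rewrite !mulr_ge0 // ?exprn_ge0 // addr_ge0 // expR_ge0.
have kL := mulr_ge0 k0 L0; have ML := mulr_ge0 M0 L0.
case: bb; last by have := hx i true; rewrite /comp => h; lra.
have hc : `|coupling x i| <= 3 ^+ d * (1 + expR 1) * (b * swt a c i t).
  by apply: coupling_le => // j; exact: (hx j false).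
have hk : `|K * coupling x i| <= k * (ell R i * (b * swt a c i t)).
  rewrite normrM (ger0_norm K0); apply: (le_trans (ler_wpM2l K0 hc)).
  have -> : K * (3 ^+ d * (1 + expR 1) * (b * swt a c i t)) = k * (b * swt a c i t).
    by rewrite /k; ring.
  exact: ler_wpM2l.
have := ler_normB (- Di) (K * coupling x i); rewrite normrN.
move: hD; rewrite -mulrA; lra.
Qed.

Lemma lattice_flow (g : R -> site d -> R -> R) (M B : R) (x0 : state R d) :
  0 <= M -> 0 <= B ->
  (forall i (u : R -> R), continuous u -> continuous (fun t => g t i (u t))) ->
  (forall t i q r, `|g t i q - g t i r| <= M * ell R i * `|q - r|) ->
  (forall t i, `|g t i (x0 i).1| <= B * ell R i) ->
  (forall i b, `|comp x0 i b| <= B * ell R i) ->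
  exists y : R -> state R d, [/\ y 0 = x0, forall t, gsolves_at K (g t) y t &
    forall t i b, `|comp (y t) i b| <= 3 * B * swt 1 (rate M) i `|t|].
Proof.
move=> M0 B0 gc gl gi xi.
set c := rate M.
have c2 : 2 <= c by exact: rate_ge.
have c0 : 0 <= c by lra.
pose st (z : site d * bool -> R) : state R d := fun i => (z (i, false), z (i, true)).
pose f (t : R) (z : site d * bool -> R) (j : site d * bool) : R :=
  if j.2 then - g t j.1 (z (j.1, false)) - K * coupling (st z) j.1 else z (j.1, true).
pose z0 (j : site d * bool) := comp x0 j.1 j.2.
have [|j t t0|j t t0|j t t0|z zc ib|t x y b b0 xy ib|t ib|z [z_0 zd zb]] :=
  @picard_global R (site d * bool)%type f z0 (fun p => swt 1 c p.1) (fun p => dswt 1 c p.1) B.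
- exact: B0.
- exact: wt_der.
- exact: wt_ge0.
- exact: dwt_ge0.
- case: ib => i b; case: b; rewrite /f /=; last exact: zc.
  move=> t; apply: cvgB; first by apply: cvgN; apply: gc; exact: zc.
  apply: cvgM; first exact: cvg_cst.
  rewrite /coupling; apply: (@cvg_big _ _ +%R 0) => [|o _] /=; first exact: add_continuous.
  by case: ifP => _; [apply: cvgB; exact: zc|exact: cvg_cst].
- case: ib => i bb.
  have := @field_bound M 1 c b 0 `|t| (fun i => (x (i, false) - y (i, false), x (i, true) - y (i, true)))
    i (g t i (x (i, false)) - g t i (y (i, false))) M0 (lexx _) (lexx _) b0 (normr_ge0 t).
  move=> /(_ _ _ (lexx _) bb); rewrite addr0 mul0r addr0 => h.
  apply: le_trans (h _ _) => {h}.
  + rewrite /f /=; case: bb => //=.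
    have -> : coupling (fun i => (x (i, false) - y (i, false), x (i, true) - y (i, true))) i =
      coupling (fun i => (x (i, false), x (i, true))) i -
      coupling (fun i => (y (i, false), y (i, true))) i.
      by rewrite couplingB; apply: coupling_eq.
    by rewrite le_eqVlt; apply/orP; left; apply/eqP; congr (`|_|); ring.
  + by move=> j []; rewrite /comp /=; exact: xy.
  + by apply: (le_trans (gl _ _ _ _)); rewrite ler_wpM2l ?xy // mulr_ge0 // (le_trans _ (ell_site_ge1 _ _)).
- case: ib => i bb.
  have [l1 w1 lw dw] := swt_bounds i (lexx 1) c0 (normr_ge0 t).
  (* One half bounds the momenta and the coupling of the initial state, the other half the force at
     it. *)
  have -> : B = B / 2 + B / 2 by field.
  apply: (@field_bound M 1 c B (B / 2) `|t| x0 i (g t i (x0 i).1)) => //.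
  + move=> j b; apply: (le_trans (xi j b)); apply: ler_wpM2l => //.
    exact: ell_le_wt.
  + apply: ler_wpDl; first by rewrite !mulr_ge0 // (le_trans _ l1, le_trans _ w1).
    apply: (le_trans (gi t i)); rewrite -mulrA; apply: ler_wpM2l => //.
    rewrite ler_pdivlMl //; apply: le_trans dw.
    have := ler_pM (_ : 0 <= 2) (_ : 0 <= ell R i) c2 (lexx (ell R i)).
    have : c * ell R i <= c * ell R i * swt 1 c i `|t|.
      by rewrite ler_peMr // mulr_ge0 // (le_trans _ l1).
    by move=> h1 h2; apply: le_trans h1; apply: h2 => //; rewrite (le_trans _ l1).
  + by rewrite divr_ge0.
exists (fun t => st (z t)); split.
- apply/funext => i; rewrite /st z_0 /z0 /comp /=; by case: (x0 i).
- by move=> t i; split; [exact: (zd t (i, false))|exact: (zd t (i, true))].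
- move=> t i b; have := zb t (i, b); rewrite /z0 /=.
  have -> : comp (st (z t)) i b = z t (i, b) by case: b.
  have [l1 w1 lw dw] := swt_bounds i (lexx 1) c0 (normr_ge0 t).
  have := xi i b; have := ler_wpM2l B0 lw.
  have := ler_normD (z t (i, b) - comp x0 i b) (comp x0 i b); rewrite subrK; lra.
Qed.

(** [D] is an abstract force difference with an error: comparing two solutions puts [eps] in the
    initial data, the linearisation remainder puts it in [D]. Any [a] and [c] above the contraction
    threshold are allowed, so that doubled weights fit. *)
Lemma lattice_stability (M T eps B a c : R) (zeta : R -> state R d) (D : R -> site d -> R) :
  0 <= M -> 0 <= eps -> 0 <= B -> 1 <= a -> rate M <= c ->
  (forall (t : R) i, `|t| <= T -> is_derive t 1 (fun s => (zeta s i).1) (zeta t i).2 /\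
     is_derive t 1 (fun s => (zeta s i).2) (- D t i - K * coupling (zeta t) i)) ->
  (forall t i, `|t| <= T ->
     `|D t i| <= M * ell R i * `|(zeta t i).1| + eps * dswt a c i `|t|) ->
  (forall i b, `|comp (zeta 0) i b| <= eps * swt a c i 0) ->
  (forall t i b, `|t| <= T -> `|comp (zeta t) i b| <= B * swt a c i `|t|) ->
  forall t i b, `|t| <= T -> `|comp (zeta t) i b| <= 2 * eps * swt a c i `|t|.
Proof.
move=> M0 e0 B0 a1 cr zd Dle z0 zB t i b tT.
have c0 : 0 <= c by have := rate_ge M0; lra.
apply: (@weighted_stability R (site d * bool)%type T eps B (fun t p => comp (zeta t) p.1 p.2)
  (fun t p => if p.2 then - D t p.1 - K * coupling (zeta t) p.1 else (zeta t p.1).2)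
  (fun p => swt a c p.1) (fun p => dswt a c p.1) e0 B0 _ _ _ _ _ _ t (i, b) tT).
- by move=> j s s0; exact: wt_der.
- by move=> j s s0; exact: wt_ge0.
- by move=> s [j bb] sT /=; case: (zd s j sT) => h1 h2; case: bb.
- move=> s b' sT b0 h [j bb] /=.
  apply: (@field_bound M a c b' eps `|s| (zeta s) j (D s j)) => //.
    by move=> k bk; exact: (h (k, bk)).
  apply: (le_trans (Dle s j sT)); rewrite lerD2r; apply: ler_wpM2l.
    by rewrite mulr_ge0 // (le_trans _ (ell_site_ge1 _ _)).
  exact: (h (j, false)).
- by move=> [j bb]; exact: z0.
- by move=> s [j bb] sT; exact: zB.
Qed.

End LatticeFlow.

(** * Clipped potentials *)

Section Clip.
Variable R : realType.

Lemma lipschitz_continuous (f : R -> R) (L : R) :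
  (forall q r, `|f q - f r| <= L * `|q - r|) -> continuous f.
Proof.
move=> fL q; apply/cvgrPdist_le => e e0.
have L1 : 0 < `|L| + 1 by rewrite ltr_wpDl.
have eL : 0 < e / (`|L| + 1) by rewrite divr_gt0.
near=> r.
have h : `|q - r| <= e / (`|L| + 1).
  by near: r; apply: cvgr_dist_le; [exact: cvg_id|].
apply: (le_trans (fL q r)); move: h; rewrite ler_pdivlMr //.
have := ler_wpM2r (normr_ge0 (q - r)) (ler_norm L).
by have := normr_ge0 (q - r); lra.
Unshelve. all: by end_near. Qed.

Definition clamp (rho q : R) : R := Num.max (- rho) (Num.min q rho).

Lemma clamp_lip (rho q r : R) : 0 <= rho -> `|clamp rho q - clamp rho r| <= `|q - r|.
Proof.
move=> r0; wlog qr : q r / r <= q.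
  move=> h; have [|/ltW] := leP r q; first exact: h.
  by rewrite distrC (distrC q); exact: h.
rewrite (ger0_norm (_ : 0 <= q - r)) ?subr_ge0 // /clamp ler_norml; clear -r0 qr.
by case: (leP q rho) => ?; case: (leP r rho) => ?; case: (leP (- rho) q) => ?;
  case: (leP (- rho) r) => ?; case: (leP (- rho) rho) => ?; apply/andP; split; lra.
Qed.

Lemma clamp_id (rho q : R) : `|q| <= rho -> clamp rho q = q.
Proof. by rewrite ler_norml => /andP[h1 h2]; rewrite /clamp min_l // max_r. Qed.

Lemma clamp_bd (rho q : R) : 0 <= rho -> `|clamp rho q| <= rho.
Proof.
by move=> r0; rewrite /clamp; case: (leP q rho) => ?; case: (leP (- rho) q) => ?;
  case: (leP (- rho) rho) => ?; rewrite ler_norml; apply/andP; split; lra.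
Qed.

Lemma clamp_up (rho q : R) : 0 <= rho -> rho <= q -> clamp rho q = rho.
Proof. by move=> r0 h; rewrite /clamp min_r // max_r //; lra. Qed.

Lemma clamp_dn (rho q : R) : 0 <= rho -> q <= - rho -> clamp rho q = - rho.
Proof. by move=> r0 h; rewrite /clamp min_l ?max_l //; lra. Qed.

Variables (U : {poly R}) (C1 : R).
Hypothesis C11 : 1 <= C1.
Hypothesis U0 : forall q, 0 <= U.[q].
Hypothesis Uq : forall q, q ^+ 4 <= C1 * (U.[q] + 1).
Hypothesis Ulip : forall q r,
  `|U^`().[q] - U^`().[r]| <= C1 * (1 + q ^+ 2 + r ^+ 2) * `|q - r|.
Hypothesis Uout : forall q, C1 <= `|q| -> 0 <= U^`().[q] * q.

Lemma poly_der (p : {poly R}) (q : R) : is_derive q 1 (fun s => p.[s]) p^`().[q].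
Proof. exact: is_derive_poly. Qed.

(** Outside [-rho, rho] the force continues with slope rho^2, the order of the Lipschitz constant of
    U' inside. A constant continuation would make V linear there and destroy the bound on q^2 that
    the coupling estimate needs. The sign condition [Uout] puts V beyond the endpoint above its
    endpoint value plus rho^2 / 2 (|q| - rho)^2, hence constants free of rho. *)
Lemma clipped_potential (rho : R) : C1 <= rho ->
  exists V G : R -> R,
  [/\ forall q : R, is_derive q 1 V (G q),
      forall q, `|q| <= rho -> V q = U.[q] /\ G q = U^`().[q],
      forall q r, `|G q - G r| <= 5 * C1 * rho ^+ 2 * `|q - r| &
  [/\ forall q, 0 <= V q,
      forall q, q ^+ 2 <= (2 * C1 + 4) * (V q + 2) &
      forall q, rho <= `|q| -> rho ^+ 4 <= C1 * (V q + 1)]].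
Proof.
move=> Crho; have C11' := C11.
have rho1 : 1 <= rho by lra.
have rho0 : 0 <= rho by lra.
have sq1 : 1 <= rho ^+ 2 by rewrite exprn_ege1.
pose G q := U^`().[clamp rho q] + rho ^+ 2 * (q - clamp rho q).
have Glip q r : `|G q - G r| <= 5 * C1 * rho ^+ 2 * `|q - r|.
  have h1 := clamp_lip q r rho0.
  have h2 := Ulip (clamp rho q) (clamp rho r).
  have bd s : (clamp rho s) ^+ 2 <= rho ^+ 2.
    by rewrite -(real_normK (num_real _)) lerXn2r ?nnegrE // clamp_bd.
  have h3 : C1 * (1 + clamp rho q ^+ 2 + clamp rho r ^+ 2) * `|clamp rho q - clamp rho r| <=
      C1 * (3 * rho ^+ 2) * `|q - r|.
    apply: ler_pM => //; first by rewrite mulr_ge0 ?addr_ge0 ?sqr_ge0 //; lra.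
    by apply: ler_wpM2l; [lra|have := bd q; have := bd r; lra].
  have -> : G q - G r = (U^`().[clamp rho q] - U^`().[clamp rho r]) +
     rho ^+ 2 * ((q - r) - (clamp rho q - clamp rho r)) by rewrite /G; ring.
  apply: (le_trans (ler_normD _ _)).
  have h4 : `|rho ^+ 2 * (q - r - (clamp rho q - clamp rho r))| <= C1 * rho ^+ 2 * (2 * `|q - r|).
    rewrite normrM (ger0_norm (sqr_ge0 _)); apply: ler_pM; rewrite ?sqr_ge0 //.
      by rewrite ler_peMl ?sqr_ge0.
    by have := ler_normB (q - r) (clamp rho q - clamp rho r); lra.
  by have := le_trans h2 h3; lra.
have [V0 [V0d V00]] := antiderivative (lipschitz_continuous Glip).
pose V q := U.[0] + V0 q.
have Vd (q : R) : is_derive q 1 V (G q).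
  by apply: (pder_eq (pderD (pderC q U.[0]) (V0d q))); rewrite add0r.
have GU q : `|q| <= rho -> G q = U^`().[q].
  by move=> h; rewrite /G clamp_id // subrr mulr0 addr0.
have VU q : `|q| <= rho -> V q = U.[q].
  move=> h; apply/eqP; rewrite -subr_eq0 -normr_le0.
  apply: (@deriv_dom_le_sym R rho (fun s => V s - U.[s]) (fun s => G s - U^`().[s])
    (fun=> 0) (fun=> 0) (fun s _ => pderB (Vd s) (poly_der U s))
    (fun s _ => pderC s 0)) => //.
  - by move=> s hs; rewrite GU // subrr normr0.
  - by rewrite /V V00 addr0 subrr normr0.
have Grho : 0 <= G rho.
  have := Uout (q := rho); rewrite ger0_norm // => /(_ Crho).
  by rewrite GU ?ger0_norm // pmulr_lge0 //; lra.
have Gmrho : G (- rho) <= 0.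
  have := Uout (q := - rho); rewrite normrN ger0_norm // => /(_ Crho).
  rewrite GU ?normrN ?ger0_norm // mulrN oppr_ge0 pmulr_lle0 //; lra.
have Vup q : rho <= q -> V rho + rho ^+ 2 / 2 * (q - rho) ^+ 2 <= V q.
  move=> hq.
  pose h s := V s - rho ^+ 2 / 2 * ((s - rho) * (s - rho)).
  have : h rho <= h q.
    apply: (@deriv_ge0_le R h (fun s => G s - rho ^+ 2 / 2 * ((s - rho) * (1 - 0) + (s - rho) * (1 - 0)))) => //.
      move=> s _; apply: pderB (Vd s) (pderZ _ _).
      exact: pderM (pderB (pder_id s) (pderC s rho)) (pderB (pder_id s) (pderC s rho)).
    move=> s /andP[hs _]; rewrite {1}/G clamp_up //.
    by move: Grho; rewrite /G clamp_up //; lra.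
  by rewrite /h subrr mulr0 mulr0 subr0 -expr2; lra.
have Vdn (q : R) : q <= - rho -> V (- rho) + rho ^+ 2 / 2 * (- q - rho) ^+ 2 <= V q.
  move=> hq.
  pose h s := V (0 + -1 * s) - rho ^+ 2 / 2 * ((s - rho) * (s - rho)).
  have : h rho <= h (- q).
    apply: (@deriv_ge0_le R h (fun s => -1 * G (0 + -1 * s) - rho ^+ 2 / 2 * ((s - rho) * (1 - 0) + (s - rho) * (1 - 0)))) => //.
    - by lra.
    - move=> s _; apply: pderB (is_derive_aff (Vd _)) (pderZ _ _).
      exact: pderM (pderB (pder_id s) (pderC s rho)) (pderB (pder_id s) (pderC s rho)).
    - move=> s /andP[hs _]; rewrite {1}/G clamp_dn //; last by lra.
      by move: Gmrho; rewrite /G clamp_dn //; lra.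
  by rewrite /h !mulN1r !add0r subrr mulr0 mulr0 subr0 -expr2 opprK; lra.
have out (q : R) : rho <= `|q| -> exists2 s : R, `|s| = rho & U.[s] + rho ^+ 2 / 2 * (`|q| - rho) ^+ 2 <= V q.
  have [q0|q0] := leP 0 q.
    rewrite (ger0_norm q0) => hq; exists rho; first by rewrite ger0_norm.
    by rewrite -VU ?ger0_norm //; exact: Vup.
  rewrite (ltr0_norm q0) => hq; exists (- rho); first by rewrite normrN ger0_norm.
  by rewrite -VU ?normrN ?ger0_norm //; apply: Vdn; lra.
have pow4 (s : R) : `|s| = rho -> rho ^+ 4 <= C1 * (U.[s] + 1).
  by move=> <-; rewrite -normrX ger0_norm ?exprn_even_ge0.
have rest0 (q : R) : 0 <= rho ^+ 2 / 2 * (`|q| - rho) ^+ 2.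
  by rewrite mulr_ge0 ?sqr_ge0 // divr_ge0 ?sqr_ge0.
have V_ge0 q : 0 <= V q.
  have [h|/ltW h] := leP `|q| rho; first by rewrite VU.
  have [s _ hs] := out q h; have := U0 s; have := rest0 q; lra.
exists V, G; split => //; first by move=> q h; split; [exact: VU|exact: GU].
split => //.
- move=> q; have V0q := V_ge0 q; have [h|/ltW h] := leP `|q| rho.
    have := Uq q; rewrite VU // in V0q *.
    have := sqr_ge0 (q ^+ 2 - 1); have := mulr_ge0 (le_trans ler01 C11) V0q.
    have -> : q ^+ 4 = q ^+ 2 * q ^+ 2 by ring.
    rewrite [_ ^+ 2]expr2; lra.
  have [s sr hs] := out q h; have u0 := U0 s.
  have k1 : (`|q| - rho) ^+ 2 <= 2 * V q.
    have : (`|q| - rho) ^+ 2 <= rho ^+ 2 * (`|q| - rho) ^+ 2 by rewrite ler_peMl ?sqr_ge0.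
    lra.
  have k2 : rho ^+ 2 <= C1 * (V q + 1).
    apply: le_trans (_ : rho ^+ 4 <= _); first by rewrite ler_weXn2l.
    apply: (le_trans (pow4 s sr)); apply: ler_wpM2l; first lra.
    by have := rest0 q; lra.
  have k3 : q ^+ 2 <= 2 * rho ^+ 2 + 2 * (`|q| - rho) ^+ 2.
    rewrite -(real_normK (num_real q)); have := sqr_ge0 (`|q| - 2 * rho); rewrite !expr2; lra.
  lra.
- move=> q /out[s sr hs]; apply: (le_trans (pow4 s sr)); apply: ler_wpM2l; first lra.
  by have := rest0 q; lra.
Qed.

End Clip.

(** * Local existence *)

Section LipschitzEnergy.
Variables (R : realType) (d : nat).

Lemma avg_energy_le_site V lam nu k (x : state R d) (m : R) :
  (forall o : {ffun 'I_d -> 'I_(k.*2.+1)}, hsite V x (cube_pt nu k o) <= m) ->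
  avg_energy V lam nu k x <= m + lam ^+ 4.
Proof.
move=> h; rewrite avg_energyE lerD2r ler_pdivrMr ?cube_size_gt0 //.
apply: (le_trans (ler_sum _ (fun o _ => h o))).
by rewrite sumr_const card_cube -[m *+ _]mulr_natr natrX.
Qed.

Lemma potential_growth (V G : R -> R) (L q : R) :
  (forall s : R, is_derive s 1 V (G s)) -> (forall s r, `|G s - G r| <= L * `|s - r|) ->
  V q <= V 0 + (`|G 0| * `|q| + L / 2 * (`|q| * `|q|)).
Proof.
move=> VG Glip.
have : `|V q - V 0| <= `|G 0| * `|q| + L / 2 * (`|q| * `|q|).
  apply: (@deriv_dom_le_sym R `|q| (fun s => V s - V 0) (fun s => G s - 0)
    (fun s => `|G 0| * s + L / 2 * (s * s))
    (fun s => `|G 0| * 1 + L / 2 * (s * 1 + s * 1))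
    (fun s _ => pderB (VG s) (pderC s _))
    (fun s _ => pderD (pderZ _ (pder_id s)) (pderZ _ (pderM (pder_id s) (pder_id s))))) => //.
    move=> s _; rewrite subr0 mulr1.
    have := Glip s 0; rewrite subr0.
    by have := ler_normD (G s - G 0) (G 0); rewrite subrK; lra.
  by rewrite subrr normr0 !mulr0 addr0.
by rewrite ler_norml => /andP[]; lra.
Qed.

Lemma hsite_subexp (V : site d -> R -> R) (y : R -> state R d) (u g M B c T : R) :
  0 <= u -> 0 <= g -> 0 <= M -> 0 <= B -> 0 <= c -> 0 <= T ->
  (forall i q, V i q <= u + (g * `|q| + M * ell R i / 2 * (`|q| * `|q|))) ->
  (forall t i b, `|comp (y t) i b| <= B * swt 1 c i `|t|) ->
  exists2 A : R, 0 <= A & forall s i, `|s| <= T -> hsite V (y s) i <= A * expR (lnorm i)%:R.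
Proof.
move=> u0 g0 M0 B0 c0 T0 Vgrow yb.
(* The third power of the weight: two factors for quadratic growth, one for [ell], which is itself
   at most the weight. *)
have [B3 B30 HB3] := wt_subexp 2 (lexx (1 : R)) c0 T0.
pose A := B ^+ 2 / 2 + (u + g * B + M * B ^+ 2 / 2) + 1.
have A0 : 0 <= A.
  have := mulr_ge0 g0 B0; have := mulr_ge0 M0 (sqr_ge0 B); have := sqr_ge0 B.
  by rewrite /A; lra.
exists (A * B3) => [|s i sT]; first exact: mulr_ge0.
have sTs : 0 <= `|s| <= T by rewrite normr_ge0.
rewrite -mulrA; apply: le_trans (ler_wpM2l A0 (HB3 (lnorm i)%:R `|s| (ler0n _ _) sTs)).
have [l1 w1 lw _] := swt_bounds i (lexx 1) c0 (normr_ge0 s).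
rewrite -/(swt 1 c i `|s|); have := yb s i true; have := yb s i false; rewrite /comp.
move: (swt 1 c i `|s|) w1 lw => w w1 lw hq hp.
have w0 : 0 <= w by exact: le_trans w1.
have w23 : w ^+ 2 <= w ^+ 3 by rewrite ler_weXn2l.
have q2 : `|(y s i).1| * `|(y s i).1| <= B ^+ 2 * w ^+ 2.
  by rewrite -exprMn -expr2 lerXn2r // nnegrE // mulr_ge0.
have t1 : (y s i).2 ^+ 2 <= B ^+ 2 * w ^+ 3.
  apply: le_trans (ler_wpM2l (sqr_ge0 B) w23).
  by rewrite -exprMn -(real_normK (num_real _)) lerXn2r // nnegrE // mulr_ge0.
have t2 : g * `|(y s i).1| <= g * B * w ^+ 3.
  rewrite -mulrA ler_wpM2l //; apply: (le_trans hq).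
  by rewrite ler_wpM2l // ler_eXnr.
have t3 : M * (ell R i * (`|(y s i).1| * `|(y s i).1|)) <= M * (B ^+ 2 * w ^+ 3).
  apply: ler_wpM2l => //; rewrite exprS [leRHS]mulrCA; apply: ler_pM => //.
  exact: le_trans l1.
have t4 : u <= u * w ^+ 3 by rewrite ler_peMr // exprn_ege1.
have t5 : 1 <= w ^+ 3 by rewrite exprn_ege1.
have := Vgrow i (y s i).1; move: t1 t2 t3 t4 t5.
rewrite /hsite /A; clear; lra.
Qed.

(** The data u, g, M, B, c of the Lipschitz dynamics enter only the exponential a priori bound and
    vanish from the conclusion; this is the uniformity in the clipping height. *)
Lemma lipschitz_energy_bound (V G : site d -> R -> R) (K C2 u g M B c T N : R)
  (y : R -> state R d) : (0 < d)%N -> 0 <= K -> 0 <= C2 -> 0 <= T ->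
  (forall i q, 0 <= V i q) ->
  (forall i q, 1 ^+ 2 * q ^+ 2 <= C2 * (V i q + 1 + 1 ^+ 4)) ->
  (forall i (q : R), is_derive q 1 (V i) (G i q)) ->
  (forall i q r, `|G i q - G i r| <= M * ell R i * `|q - r|) ->
  (forall i, V i 0 <= u) -> (forall i, `|G i 0| <= g) ->
  0 <= M -> 0 <= B -> 0 <= c ->
  (forall t, gsolves_at K G y t) ->
  (forall t i b, `|comp (y t) i b| <= B * swt 1 c i `|t|) ->
  bnd V (y 0) N ->
  forall s, `|s| <= T -> bnd V (y s) ((N + 1) * expR (speed d K C2 1 * T)).
Proof.
move=> d0 K0 C20 T0 V0 Vq VG Glip Vu Gg M0 B0 c0 ysol yb yN s sT.
have N0 : 0 <= N + 1 by apply: addr_ge0 => //; apply: le_trans (bnd_ge1 d0 V0 yN).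
pose o : site d := [ffun=> 0].
have [||i q|A A0 hA] := @hsite_subexp V y u g M B c T _ _ M0 B0 c0 T0 _ yb.
- exact: le_trans (V0 o 0) (Vu o).
- exact: le_trans (normr_ge0 _) (Gg o).
- apply: (le_trans (potential_growth q (VG i) (Glip i))).
  by apply: lerD; [exact: Vu|rewrite lerD2r ler_wpM2r].
apply: (@bnd_of_avg_energy R d V 1) => nu k kadm.
pose e : R := if 0 <= s then 1 else -1.
have es : s = 0 + e * `|s|.
  by rewrite /e; have [h|h] := leP 0 s; rewrite ?(ger0_norm h) ?(ltr0_norm h); ring.
have e1 : `|e| = 1 by rewrite /e; case: ifP; rewrite ?normrN normr1.
have eT r : 0 <= r <= `|s| -> `|0 + e * r| <= T.
  by case/andP => r0 rs; rewrite add0r normrM e1 mul1r ger0_norm // (le_trans rs).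
have A10 : 0 <= (A + 1) * expR ((lnorm nu)%:R + d%:R * k%:R).
  by rewrite mulr_ge0 ?expR_ge0 // addr_ge0.
have := @energy_gronwall R d K V G C2 1 K0 C20 ltr01 V0 Vq VG
  y 0 e `|s| (N + 1) _ d%:R nu k e1 (normr_ge0 s) N0 A10.
rewrite -es => /(_ _ _ _ 0%N); rewrite addn0 => h.
apply: le_trans (h _ _ _) _ => {h}.
- by move=> r _; exact: ysol.
- move=> k' r rs.
  apply: le_trans (_ : A * expR ((lnorm nu)%:R + d%:R * (k + k')%:R) + 1 ^+ 4 <= _).
    apply: avg_energy_le_site => p; apply: (le_trans (hA _ _ (eT r rs))).
    rewrite ler_wpM2l // ler_expR -natrM -natrD ler_nat; exact: lnorm_cube_pt.
  rewrite expr1n -[leRHS]mulrA -expRD natrD mulrDr addrA [leRHS]mulrDl mul1r lerD2l.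
  by rewrite -expR0 ler_expR !addr_ge0 // -?natrM.
- move=> k'; rewrite -[leRHS]/(N + 1) -[X in N + X](expr1n R 4).
  by apply: avg_energy_le => //; apply: adm_le kadm; rewrite leq_addr.
- by rewrite ler_wpM2l // ler_expR ler_wpM2l // speed_ge0.
Qed.

End LipschitzEnergy.

Section LocalSolution.
Variables (R : realType) (d : nat) (U : {poly R}) (K C1 : R).
Hypotheses (d0 : (0 < d)%N) (K0 : 0 < K) (C11 : 1 <= C1).
Hypothesis U0 : forall q, 0 <= U.[q].
Hypothesis Uq : forall q, q ^+ 4 <= C1 * (U.[q] + 1).
Hypothesis Ulip : forall q r,
  `|U^`().[q] - U^`().[r]| <= C1 * (1 + q ^+ 2 + r ^+ 2) * `|q - r|.
Hypothesis Uout : forall q, C1 <= `|q| -> 0 <= U^`().[q] * q.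

Definition onsite : site d -> R -> R := fun _ q => U.[q].
Definition onsite_force : site d -> R -> R := fun _ q => U^`().[q].

Lemma quartic_ge_sqr (x : state R d) N i : bnd onsite x N ->
  [/\ (x i).1 ^+ 4 <= C1 * (5 ^+ d * N) * ell R i,
      (x i).1 ^+ 2 <= 2 * C1 * (5 ^+ d * N) * ell R i &
      (x i).2 ^+ 2 <= 2 * (5 ^+ d * N) * ell R i].
Proof.
move=> xN; have h := bnd_site i d0 (fun _ => U0) xN.
have C11' := C11; have C10 : 0 <= C1 by lra.
have u0 := U0 (x i).1; have p0 := sqr_ge0 (x i).2.
split.
- apply: (le_trans (Uq _)); rewrite -mulrA ler_wpM2l //; apply: le_trans h.
  by rewrite /hsite /onsite; lra.
- apply: (le_trans (sqr_le_hsite C11 U0 Uq x i)); rewrite -mulrA -(mulrA (2 * C1)).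
  by rewrite -!mulrA ler_wpM2l // ler_wpM2l // mulrA.
- by move: h; rewrite /hsite /onsite -!mulrA; lra.
Qed.

Lemma deriv_bound_site (q A : R) i : 0 <= A -> q ^+ 4 <= A * ell R i ->
  `|U^`().[q]| <= (`|U^`().[0]| + C1 + C1 * A) * ell R (i : site d).
Proof.
move=> A0 h; have l1 := ell_site_ge1 R i.
have C11' := C11.
have := Ulip q 0; rewrite subr0 expr0n addr0 => h1.
have h2 : (1 + q ^+ 2) * `|q| <= 1 + q ^+ 4.
  have : (1 + q ^+ 2) * `|q| <= (1 + q ^+ 2) * ((1 + q ^+ 2) / 2).
    by apply: ler_wpM2l; [rewrite addr_ge0 ?sqr_ge0|exact: abs_le_sqr].
  have := sqr_ge0 (q ^+ 2 - 1).
  have -> : q ^+ 4 = q ^+ 2 * q ^+ 2 by ring.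
  by rewrite [_ ^+ 2]expr2; lra.
have h3 := ler_normD (U^`().[q] - U^`().[0]) U^`().[0]; rewrite subrK in h3.
have n0 := normr_ge0 U^`().[0].
have h4 : `|U^`().[0]| <= `|U^`().[0]| * ell R i by rewrite ler_peMr.
have h5 : C1 * ((1 + q ^+ 2) * `|q|) <= C1 * (ell R i + A * ell R i).
  by apply: ler_wpM2l; lra.
by move: h1; rewrite -mulrA; lra.
Qed.

Lemma local_solution (x0 : state R d) (N T : R) : 0 <= T -> bnd onsite x0 N ->
  exists y : R -> state R d, y 0 = x0 /\ forall t, `|t| <= T ->
    gsolves_at K onsite_force y t /\
    bnd onsite (y t) ((N + 1) * expR (speed d K (2 * C1 + 4) 1 * T)).
Proof.
move=> T0 xN.
have N1 : 1 <= N by exact: (bnd_ge1 d0 (fun _ => U0) xN).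
have C11' := C11; have C10 : 0 <= C1 by lra.
set sp := speed d K (2 * C1 + 4) 1.
have sp0 : 0 <= sp by apply: speed_ge0 => //; [exact: ltW|lra].
set Nt := (N + 1) * _.
have NNt : N <= Nt.
  have : N + 1 <= Nt by rewrite ler_peMr //; [lra|rewrite -expR0 ler_expR mulr_ge0].
  lra.
have f1 : 1 <= 5 ^+ d :> R by rewrite exprn_ege1 // ler1n.
(* C1^2 ensures rho >= C1; the other term places the initial positions below the clip and makes
   reaching it contradict the energy bound [Nt]. *)
pose r := C1 ^+ 2 + 2 * C1 * (5 ^+ d * Nt + 2).
have fN0 : 0 <= 5 ^+ d * N by rewrite mulr_ge0 //; lra.
have fNt : 5 ^+ d * N <= 5 ^+ d * Nt by rewrite ler_wpM2l //; lra.
have CfN : C1 * (5 ^+ d * N) <= C1 * (5 ^+ d * Nt) by rewrite ler_wpM2l.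
have CfN0 : 0 <= C1 * (5 ^+ d * N) by rewrite mulr_ge0.
have rC : C1 ^+ 2 <= r by rewrite /r lerDl mulr_ge0 //; lra.
have r1 : 1 <= r by apply: le_trans rC; rewrite exprn_ege1.
have rge : C1 * (5 ^+ d * Nt + 2) <= r.
  by rewrite /r; have := sqr_ge0 C1; lra.
pose rho i := Num.sqrt (r * ell R (i : site d)).
have rl i : 1 <= ell R (i : site d) by exact: ell_site_ge1.
have rho2 i : rho i ^+ 2 = r * ell R i.
  by rewrite sqr_sqrtr //; apply: mulr_ge0; [exact: le_trans r1|exact: le_trans (rl i)].
have rhoC i : C1 <= rho i.
  rewrite -(ler_pXn2r (n := 2)) ?nnegrE ?sqrtr_ge0 // rho2.
  by apply: (le_trans rC); rewrite ler_peMr // (le_trans _ r1).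
have [V /choice [G VG]] := choice (fun i => clipped_potential C11 U0 Uq Ulip Uout (rhoC i)).
have VGd i (q : R) : is_derive q 1 (V i) (G i q).
  by case: (VG i).
have VGU i q : `|q| <= rho i -> V i q = U.[q] /\ G i q = U^`().[q].
  by case: (VG i) => _ h _ _; exact: h.
have Glip i q r' : `|G i q - G i r'| <= 5 * C1 * r * ell R i * `|q - r'|.
  by rewrite -(mulrA (5 * C1)) -rho2; case: (VG i) => _ _ h _; exact: h.
have V0 i q : 0 <= V i q by case: (VG i) => _ _ _ [h _ _]; exact: h.
have Vq i q : 1 ^+ 2 * q ^+ 2 <= (2 * C1 + 4) * (V i q + 1 + 1 ^+ 4).
  rewrite !expr1n mul1r -addrA; have -> : 1 + 1 = 2 :> R by ring.
  by case: (VG i) => _ _ _ [_ h _]; exact: h.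
have Vout i q : rho i <= `|q| -> rho i ^+ 4 <= C1 * (V i q + 1).
  by case: (VG i) => _ _ _ [_ _ h]; exact: h.
have x0in i : `|(x0 i).1| <= rho i.
  rewrite -(ler_pXn2r (n := 2)) ?nnegrE ?sqrtr_ge0 // real_normK ?num_real // rho2.
  have [_ h _] := quartic_ge_sqr i xN; apply: (le_trans h); apply: ler_wpM2r.
    by rewrite (le_trans _ (rl i)).
  by rewrite /r -mulrA; have := sqr_ge0 C1; lra.
pose B := `|U^`().[0]| + C1 + C1 * (C1 * (5 ^+ d * N)) + 1 + C1 * (5 ^+ d * N) + 5 ^+ d * N.
have CC0 : 0 <= C1 * (C1 * (5 ^+ d * N)) by rewrite mulr_ge0.
have B0 : 0 <= B by rewrite /B; have := normr_ge0 U^`().[0]; lra.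
have M0 : 0 <= 5 * C1 * r by rewrite !mulr_ge0 //; lra.
have K0' := ltW K0.
have [|t i|i b|y [y0 ysol yb]] :=
  @lattice_flow R d K K0' (fun=> G) (5 * C1 * r) B x0 M0 B0 _ (fun _ => Glip).
- move=> i u uc t; apply: (@continuous_comp _ _ _ u (G i)); first exact: uc.
  exact: lipschitz_continuous (Glip i) _.
- have [_ ->] := VGU i _ (x0in i).
  have [h _ _] := quartic_ge_sqr i xN.
  apply: (le_trans (deriv_bound_site CfN0 h)); rewrite ler_wpM2r ?(le_trans _ (rl i)) //.
  by rewrite /B; lra.
- have [_ h1 h2] := quartic_ge_sqr i xN; have l1 := rl i.
  have := normr_ge0 U^`().[0] => n0.
  have hB : (1 + C1 * (5 ^+ d * N) + 5 ^+ d * N) * ell R i <= B * ell R i.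
    by rewrite ler_wpM2r ?(le_trans _ l1) // /B; lra.
  apply: le_trans hB.
  have e0 : 0 <= ell R i by lra.
  have a1 := mulr_ge0 CfN0 e0; have a2 := mulr_ge0 fN0 e0.
  case: b; rewrite /comp.
    by have := abs_le_sqr (x0 i).2; lra.
  by have := abs_le_sqr (x0 i).1; lra.
exists y; split => // t tT.
have c0 : 0 <= rate d K (5 * C1 * r) by apply: le_trans (rate_ge d K0' M0).
have V00 i : V i 0 = U.[0] /\ G i 0 = U^`().[0] by apply: VGU; rewrite normr0 sqrtr_ge0.
have C40 : 0 <= 2 * C1 + 4 by rewrite addr_ge0 // mulr_ge0.
have yN : bnd V (y 0) N.
  rewrite y0 => nu k kadm; apply: le_trans (xN nu k kadm); apply: ler_sum => o _.
  by rewrite /hsite /onsite; have [-> _] := VGU _ _ (x0in (cube_pt nu k o)).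
have B30 : 0 <= 3 * B by rewrite mulr_ge0.
have bndV s : `|s| <= T -> bnd V (y s) Nt.
  apply: (@lipschitz_energy_bound R d V G K (2 * C1 + 4) U.[0] `|U^`().[0]| _ _ _ T N y
    d0 K0' C40 T0 V0 Vq VGd Glip _ _ M0 B30 c0 ysol yb yN) => i.
    by have [->] := V00 i.
  by have [_ ->] := V00 i.
have Nt0 : 0 <= 5 ^+ d * Nt by exact: le_trans fN0 fNt.
(* At the clip, rho^4 = (r ell)^2 would be at most C1 times the site energy, hence at most C1 5^d Nt
   ell, which is less than r ell. No exit-time argument is needed, since the bound [Nt] holds for
   the clipped dynamics on the whole interval. *)
have small i s : `|s| <= T -> `|(y s i).1| <= rho i.
  move=> sT; rewrite leNgt; apply/negP => /ltW out.
  have h1 := bnd_site i d0 V0 (bndV s sT).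
  have h2 := Vout i _ out.
  have h3 : V i (y s i).1 + 1 <= 5 ^+ d * Nt * ell R i.
    by apply: le_trans h1; rewrite /hsite; have := sqr_ge0 (y s i).2; lra.
  have h4 : rho i ^+ 4 <= C1 * (5 ^+ d * Nt * ell R i).
    by apply: (le_trans h2); apply: ler_wpM2l.
  have l1 := rl i.
  have e4 : rho i ^+ 4 = r * ell R i * (r * ell R i).
    by rewrite -rho2; ring.
  have h5 : C1 * (5 ^+ d * Nt + 2) * ell R i <= r * ell R i.
    by apply: ler_wpM2r => //; lra.
  have h6 : r * ell R i <= r * ell R i * (r * ell R i).
    have k1 : 1 <= r * ell R i by have := ler_pM ler01 ler01 r1 l1; rewrite mulr1.
    exact: ler_peMr (le_trans ler01 k1) k1.
  have h7 : 1 <= C1 * ell R i by have := ler_pM ler01 ler01 C11' l1; rewrite mulr1.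
  by move: h4; rewrite e4; lra.
split.
  move=> i; have [h1 h2] := ysol t i; split => //.
  by have [_ e] := VGU i _ (small i t tT); rewrite /onsite_force -e.
move=> nu k kadm; apply: le_trans (bndV t tT nu k kadm); apply: ler_sum => o _.
by rewrite /hsite /onsite; have [-> _] := VGU _ _ (small (cube_pt nu k o) t tT).
Qed.

End LocalSolution.

(** * Global existence and uniqueness *)

Section GlobalSolution.
Variables (R : realType) (d : nat) (U : {poly R}) (K C1 : R).
Hypotheses (d0 : (0 < d)%N) (K0 : 0 < K) (C11 : 1 <= C1).
Hypothesis U0 : forall q, 0 <= U.[q].
Hypothesis Uq : forall q, q ^+ 4 <= C1 * (U.[q] + 1).
Hypothesis Ulip : forall q r,
  `|U^`().[q] - U^`().[r]| <= C1 * (1 + q ^+ 2 + r ^+ 2) * `|q - r|.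
Hypothesis Uout : forall q, C1 <= `|q| -> 0 <= U^`().[q] * q.

Let UV : site d -> R -> R := onsite U.
Let UG : site d -> R -> R := onsite_force U.

Lemma bnd_mono V (x : state R d) (N N' : R) : N <= N' -> bnd V x N -> bnd V x N'.
Proof.
move=> NN h nu k kadm; apply: (le_trans (h nu k kadm)).
by rewrite ler_wpM2r // ltW // cube_size_gt0.
Qed.

(** The argument of [rate] is the Lipschitz constant of U' per unit of [ell] between two states with
    bound N, each squared position contributing 2 C1 5^d N. *)
Definition lip_rate (N : R) : R := rate d K (C1 * (1 + 4 * C1 * (5 ^+ d * N))).

Lemma comp_le_ell (x : state R d) N i b : bnd UV x N ->
  `|comp x i b| <= (1 + C1 * (5 ^+ d * N) + 5 ^+ d * N) * ell R i.
Proof.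
move=> xN; have N1 := bnd_ge1 d0 (fun _ => U0) xN.
have [_ h1 h2] := quartic_ge_sqr d0 C11 U0 Uq i xN.
have l1 := ell_site_ge1 R i; have C11' := C11.
have f0 : 0 <= 5 ^+ d * N * ell R i by rewrite !mulr_ge0 ?exprn_ge0 //; lra.
have Cf0 : 0 <= C1 * (5 ^+ d * N) * ell R i.
  by rewrite -(mulrA C1) mulr_ge0 //; lra.
case: b; rewrite /comp.
  by have := abs_le_sqr (x i).2; lra.
by have := abs_le_sqr (x i).1; lra.
Qed.

Lemma solution_stability (N T eps : R) (y y' : R -> state R d) : 0 <= T -> 0 <= eps ->
  (forall t, `|t| <= T -> gsolves_at K UG y t /\ bnd UV (y t) N) ->
  (forall t, `|t| <= T -> gsolves_at K UG y' t /\ bnd UV (y' t) N) ->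
  (forall i b, `|comp (y 0) i b - comp (y' 0) i b| <= eps * swt 1 (lip_rate N) i 0) ->
  forall t i b, `|t| <= T ->
    `|comp (y t) i b - comp (y' t) i b| <= 2 * eps * swt 1 (lip_rate N) i `|t|.
Proof.
move=> T0 e0 ys ys' init t i b tT.
have T00 : `|0 : R| <= T by rewrite normr0.
have N1 := bnd_ge1 d0 (fun _ => U0) (ys 0 T00).2.
have C11' := C11.
set M := C1 * (1 + 4 * C1 * (5 ^+ d * N)).
have f0 : 0 <= 5 ^+ d * N by rewrite !mulr_ge0 ?exprn_ge0 //; lra.
have Cf0 : 0 <= C1 * (5 ^+ d * N) by rewrite mulr_ge0 //; lra.
have M0 : 0 <= M by rewrite /M mulr_ge0 //; lra.
have c0 : 0 <= rate d K M by have := rate_ge d (ltW K0) M0; lra.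
pose zeta s j := ((y s j).1 - (y' s j).1, (y s j).2 - (y' s j).2).
have compE s j b' : comp (zeta s) j b' = comp (y s) j b' - comp (y' s) j b' by case: b'.
rewrite -compE.
pose B0 := 1 + C1 * (5 ^+ d * N) + 5 ^+ d * N.
have B00 : 0 <= B0 by rewrite /B0; lra.
apply: (@lattice_stability R d K (ltW K0) M T eps (2 * B0) 1 (rate d K M) zeta
  (fun s j => U^`().[(y s j).1] - U^`().[(y' s j).1])) => //.
- by rewrite mulr_ge0.
- move=> s j sT; have [h1 h2] := (ys s sT).1 j; have [h3 h4] := (ys' s sT).1 j.
  split; first exact: pderB.
  apply: (pder_eq (pderB h2 h4)); rewrite /UG /onsite_force.
  have <- : coupling (y s) j - coupling (y' s) j = coupling (zeta s) j.
    by rewrite couplingB; apply: coupling_eq.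
  by ring.
- move=> s j sT; apply: ler_wpDr.
    by rewrite mulr_ge0 // dwt_ge0.
  apply: (le_trans (Ulip _ _)); rewrite ler_wpM2r //.
  have [_ h1 _] := quartic_ge_sqr d0 C11 U0 Uq j (ys s sT).2.
  have [_ h2 _] := quartic_ge_sqr d0 C11 U0 Uq j (ys' s sT).2.
  rewrite /M -mulrA; apply: ler_wpM2l; first lra.
  by have := ell_site_ge1 R j; lra.
- by move=> j b'; rewrite compE; exact: init.
- move=> s j b' sT; rewrite compE; apply: (le_trans (ler_normB _ _)).
  have h1 := comp_le_ell j b' (ys s sT).2; have h2 := comp_le_ell j b' (ys' s sT).2.
  have [_ _ lw _] := swt_bounds j (lexx 1) c0 (normr_ge0 s).
  by have := ler_wpM2l B00 lw; rewrite /B0 in h1 h2 *; lra.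
Qed.

Lemma local_unique (N T : R) (y y' : R -> state R d) : 0 <= T ->
  (forall t, `|t| <= T -> gsolves_at K UG y t /\ bnd UV (y t) N) ->
  (forall t, `|t| <= T -> gsolves_at K UG y' t /\ bnd UV (y' t) N) ->
  y 0 = y' 0 -> forall t, `|t| <= T -> y t = y' t.
Proof.
move=> T0 ys ys' e0 t tT; apply/funext => i.
have h b : comp (y t) i b = comp (y' t) i b.
  have := @solution_stability N T 0 y y' T0 (lexx _) ys ys' _ t i b tT.
  rewrite mulr0 mul0r normr_le0 subr_eq0 => h; apply/eqP/h => j b'.
  by rewrite e0 subrr normr0 mul0r.
by have := h true; have := h false; rewrite /comp; case: (y t i) (y' t i) => ? ? [? ?] /= -> ->.
Qed.

Lemma global_solution (x : state R d) N : bnd UV x N ->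
  exists y : R -> state R d, [/\ y 0 = x, forall t, gsolves_at K UG y t &
    forall t, exists N', bnd UV (y t) N'].
Proof.
move=> xN; have N1 := bnd_ge1 d0 (fun _ => U0) xN; have C11' := C11.
pose N' (T : R) := (N + 1) * expR (speed d K (2 * C1 + 4) 1 * T).
have sp0 : 0 <= speed d K (2 * C1 + 4) 1 by apply: speed_ge0 => //; [exact: ltW|lra].
have N'mono S T : S <= T -> N' S <= N' T.
  by move=> ST; rewrite ler_wpM2l ?ler_expR ?ler_wpM2l //; lra.
have [Y YP] := choice (fun n : nat =>
  local_solution d0 K0 C11 U0 Uq Ulip Uout (ler0n R n) xN).
have agree m n s : `|s| <= m%:R -> `|s| <= n%:R -> Y m s = Y n s.
  move=> sm sn; set T : R := n%:R; set S : R := m%:R.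
  apply: (@local_unique (Num.max (N' S) (N' T)) `|s|) => //.
  - move=> t ts; have [h1 h2] := (YP m).2 t (le_trans ts sm); split => //.
    by apply: bnd_mono h2; rewrite le_max lexx.
  - move=> t ts; have [h1 h2] := (YP n).2 t (le_trans ts sn); split => //.
    by apply: bnd_mono h2; rewrite le_max lexx orbT.
  - by rewrite (YP m).1 (YP n).1.
pose y t := Y (Num.truncn `|t|).+1 t.
have ub (t : R) : `|t| <= (Num.truncn `|t|).+1%:R :> R by rewrite ltW // truncnS_gt.
have yE n s : `|s| <= n%:R -> y s = Y n s by move=> sn; exact: agree.
exists y; split.
- by rewrite (yE 0%N) ?normr0 //; exact: (YP 0%N).1.
(* A derivative sees a neighbourhood of t, so the index must satisfy |t| < n strictly. *)
- move=> t i; set n := (Num.truncn `|t|).+2.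
  have tn : `|t| < n%:R by apply: lt_le_trans (truncnS_gt `|t|) _; rewrite ler_nat.
  have nr : \near t, Y n t = y t.
    have nn : \forall s \near t, `|s| < n%:R by exact: (cvgr_lt _ (@norm_continuous R R t) _ tn).
    by apply: filterS nn => s sn; apply/esym/yE/ltW.
  have [h1 h2] := ((YP n).2 t (ltW tn)).1 i.
  rewrite (yE n t (ltW tn)); split.
    by apply: near_eq_is_derive h1; apply: filterS nr => s ->.
  by apply: near_eq_is_derive h2; apply: filterS nr => s ->.
- by move=> t; exists (N' (Num.truncn `|t|).+1%:R); have [_ h] := (YP (Num.truncn `|t|).+1).2 t (ub t); exact: h.
Qed.

Lemma quartic_scaled (lam q : R) : lam ^+ 2 * q ^+ 2 <= (2 * C1 + 4) * (U.[q] + 1 + lam ^+ 4).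
Proof.
have := Uq q; have u0 := U0 q; have C11' := C11.
have C10 : 0 <= C1 by lra.
have l4 : 0 <= lam ^+ 4 by rewrite exprn_even_ge0.
have := sqr_ge0 (q ^+ 2 - lam ^+ 2); have := mulr_ge0 C10 u0; have := mulr_ge0 C10 l4.
have -> : q ^+ 4 = q ^+ 2 * q ^+ 2 by ring.
move: l4; have -> : lam ^+ 4 = lam ^+ 2 * lam ^+ 2 by ring.
by rewrite [(_ - _) ^+ 2]expr2; lra.
Qed.

(** The solution is only pointwise in time in X_0. The Baire argument, fed with the two directions
    of Gronwall, bounds the averages on the time interval uniformly in k; then the chain applies
    with D = 0. *)
Lemma solution_energy (y : R -> state R d) N (lam : R) : 0 < lam ->
  (forall t, gsolves_at K UG y t) -> (forall t, exists N', bnd UV (y t) N') ->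
  bnd UV (y 0) N ->
  forall t, bnd UV (y t) ((N + lam ^+ 4) * expR (speed d K (2 * C1 + 4) lam * `|t|)).
Proof.
move=> lam0 ysol ybd yN t; apply: (@bnd_of_avg_energy R d UV lam) => nu k kadm.
have N1 := bnd_ge1 d0 (fun _ => U0) yN; have C11' := C11.
have C40 : 0 <= 2 * C1 + 4 by lra.
have V0 : forall (j : site d) q, 0 <= UV j q by move=> j q; exact: U0.
have VG : forall i (q : R), is_derive q 1 (UV i) (UG i q) by move=> j q; exact: poly_der.
have Vq : forall (j : site d) q, lam ^+ 2 * q ^+ 2 <= (2 * C1 + 4) * (UV j q + 1 + lam ^+ 4).
  by move=> j q; exact: quartic_scaled.
have l4 : 0 <= lam ^+ 4 by rewrite exprn_even_ge0.
set C := speed d K (2 * C1 + 4) lam.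
have Cge0 : 0 <= C by apply: speed_ge0 => //; exact: ltW.
pose s j u := avg_energy UV lam nu (k + j)%N (y u).
have s0 j u : 0 <= s j u by exact: avg_energy_ge0.
have gron (a e T M m : R) : `|e| = 1 -> 0 <= T ->
    (forall j u, 0 <= u <= T -> s j (a + e * u) <= M) -> (forall j, s j a <= m) ->
    forall j, s j (a + e * T) <= m * expR (C * T).
  move=> e1 T0 hM hm j.
  have M0 : 0 <= M by apply: le_trans (hM 0%N 0 _); rewrite ?s0 // lexx.
  have m0 : 0 <= m by exact: le_trans (s0 0%N a) (hm 0%N).
  apply: (@energy_gronwall R d K UV UG (2 * C1 + 4) lam (ltW K0) C40 lam0 V0 Vq VG
    y a e T m M 0 nu k e1 T0 m0 M0) => //.
  by move=> j' u uT; rewrite mul0r expR0 mulr1; exact: hM.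
have locbd a b : a <= b -> exists M, forall j u, a <= u <= b -> s j u <= M.
  apply: (@ptw_bounded_locally_bounded R s C Cge0).
  - move=> j u; have [D hD _] := avg_energy_der (ltW K0) C40 lam0 V0 Vq VG nu (k + j) (ysol u).
    exact: is_derive_cont hD.
  - exact: s0.
  - move=> u; have [N' hN'] := ybd u; exists (N' + lam ^+ 4) => j.
    by apply: avg_energy_le hN' _; apply: adm_le kadm; rewrite leq_addr.
  - move=> a' b' M m ab hM hm j.
    have -> : s j b' = s j (a' + 1 * (b' - a')) by congr (s j _); ring.
    apply: (gron _ _ _ M) => //; [exact: normr1|lra|].
    by move=> j' u ub; apply: hM; lra.
  - move=> a' b' M m ab hM hm j.
    have -> : s j a' = s j (b' + -1 * (b' - a')) by congr (s j _); ring.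
    apply: (gron _ _ _ M) => //; [by rewrite normrN normr1|lra|].
    by move=> j' u ub; apply: hM; lra.
have [M HM] : exists M, forall j u, - `|t| <= u <= `|t| -> s j u <= M.
  by apply: locbd; have := normr_ge0 t; lra.
pose e : R := if 0 <= t then 1 else -1.
have et : t = 0 + e * `|t|.
  by rewrite /e; have [h|h] := leP 0 t; rewrite ?(ger0_norm h) ?(ltr0_norm h); ring.
have e1 : `|e| = 1 by rewrite /e; case: ifP; rewrite ?normrN normr1.
have init j : s j 0 <= N + lam ^+ 4.
  by apply: avg_energy_le yN _; apply: adm_le kadm; rewrite leq_addr.
have := gron 0 e `|t| M (N + lam ^+ 4) e1 (normr_ge0 t) _ init 0%N.
rewrite -et /s addn0; apply => j u /andP[u0 ut]; apply: HM.
rewrite -ler_norml add0r normrM e1 mul1r ger0_norm //.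
Qed.

Lemma solution_unique (y y' : R -> state R d) :
  (forall t, gsolves_at K UG y t) -> (forall t, exists N', bnd UV (y t) N') ->
  (forall t, gsolves_at K UG y' t) -> (forall t, exists N', bnd UV (y' t) N') ->
  y 0 = y' 0 -> forall t, y t = y' t.
Proof.
move=> ys yb ys' yb' e0 t.
have [N hN] := yb 0.
have N1 := bnd_ge1 d0 (fun _ => U0) hN; have C11' := C11.
have hN' : bnd UV (y' 0) N by rewrite -e0.
have sp0 : 0 <= speed d K (2 * C1 + 4) 1 by apply: speed_ge0 => //; [exact: ltW|lra].
have up (z : R -> state R d) : (forall t, gsolves_at K UG z t) ->
    (forall t, exists N', bnd UV (z t) N') -> bnd UV (z 0) N ->
    forall s, `|s| <= `|t| -> gsolves_at K UG z s /\
      bnd UV (z s) ((N + 1 ^+ 4) * expR (speed d K (2 * C1 + 4) 1 * `|t|)).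
  move=> zs zb zN s st; split => //.
  apply: bnd_mono (solution_energy ltr01 zs zb zN s).
  by rewrite ler_wpM2l ?ler_expR ?ler_wpM2l // expr1n; lra.
exact: (@local_unique _ `|t| y y' (normr_ge0 t) (up _ ys yb hN) (up _ ys' yb' hN') e0 t (lexx _)).
Qed.

End GlobalSolution.

(** * Differentiability in the initial data *)

Lemma differentiable_quadratic_remainder (R : realType) (f : R * R -> R) (w : R * R)
  (a b C : R) :
  (\forall v \near w, `|f v - f w - (a * (v.1 - w.1) + b * (v.2 - w.2))| <= C * `|v - w| ^+ 2) ->
  differentiable f w.
Proof.
move=> h.
pose r v := f v - f w - (a * (v.1 - w.1) + b * (v.2 - w.2)).
have rw : r w = 0 by rewrite /r !subrr !mulr0 addr0 subrr.
have ro : r \o shift w = cst (r w) + \0 +o_ (0 : R * R) id.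
  apply/eqaddoP => e e0.
  have C1 : 0 < `|C| + 1 by rewrite ltr_wpDl.
  have eC : 0 < e / (`|C| + 1) by rewrite divr_gt0.
  have h0 : \forall u \near (0 : R * R), `|r (u + w)| <= C * `|u| ^+ 2.
    have : \forall v \near w, `|r v| <= C * `|v - w| ^+ 2 by [].
    rewrite (near_shift 0 w) /=; apply: filterS => u; rewrite /= subr0.
    by rewrite -addrA subrr addr0.
  have h1 : \forall u \near (0 : R * R), `|u| <= e / (`|C| + 1) by exact: nbhs0_le.
  apply: filterS2 h0 h1 => u hu us.
  rewrite /= rw !fctE /= addr0 subr0 /shift /=.
  apply: (le_trans hu); rewrite expr2 mulrA ler_wpM2r //.
  move: us; rewrite ler_pdivlMr //.
  have := ler_wpM2r (normr_ge0 u) (ler_norm C); have := normr_ge0 u; lra.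
have rd : differentiable r w.
  have c0 : continuous (\0 : R * R -> R) by exact: cst_continuous.
  apply/diff_locallyP; rewrite (diff_unique c0 ro); split => //.
have -> : f = r + (fun v => f w + (a * (v.1 - w.1) + b * (v.2 - w.2))).
  by apply/funext => v; rewrite !fctE /r; ring.
apply: differentiableD => //; apply: differentiableD => //.
have d1 : differentiable (fun v : R * R => v.1 - w.1) w.
  apply: differentiableB => //; apply: (@linear_differentiable R (R * R)%type R fst).
  by move=> v; exact: cvg_fst.
have d2 : differentiable (fun v : R * R => v.2 - w.2) w.
  apply: differentiableB => //; apply: (@linear_differentiable R (R * R)%type R snd).
  by move=> v; exact: cvg_snd.
by apply: differentiableD; apply: differentiableM.
Qed.

Lemma rate_ge_double (R : realType) d (K M : R) : 0 <= K -> 2 * M <= rate d K M.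
Proof.
move=> K0; have : 0 <= K * 3 ^+ d * (1 + expR 1).
  by rewrite !mulr_ge0 // ?exprn_ge0 // addr_ge0 // expR_ge0.
by rewrite /rate; lra.
Qed.

Section FlowDifferentiability.
Variables (R : realType) (d : nat) (U : {poly R}) (K C1 : R) (U2 : R -> R).
Hypotheses (d0 : (0 < d)%N) (K0 : 0 < K) (C11 : 1 <= C1).
Hypothesis U0 : forall q, 0 <= U.[q].
Hypothesis Uq : forall q, q ^+ 4 <= C1 * (U.[q] + 1).
Hypothesis Ulip : forall q r,
  `|U^`().[q] - U^`().[r]| <= C1 * (1 + q ^+ 2 + r ^+ 2) * `|q - r|.
Hypothesis Utaylor : forall q r, `|U^`().[q] - U^`().[r] - U2 r * (q - r)| <=
  C1 * (1 + q ^+ 2 + r ^+ 2) * (q - r) ^+ 2.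
Hypothesis U2bd : forall q, `|U2 q| <= C1 * (1 + q ^+ 2).
Hypothesis U2c : continuous U2.

Let UV : site d -> R -> R := onsite U.
Let UG : site d -> R -> R := onsite_force U.

Definition site_energy (v : R * R) : R := v.2 ^+ 2 / 2 + U.[v.1] + 1.

Lemma site_energy_ge0 v : 0 <= site_energy v.
Proof. by rewrite /site_energy; have := sqr_ge0 v.2; have := U0 v.1; lra. Qed.

(** Offsets enumerate a cube injectively, so site i is met at most once, and cubes have volume at
    least 1. *)
Lemma upd_bnd (x : state R d) N i v : bnd UV x N -> bnd UV (upd x i v) (N + site_energy v).
Proof.
move=> xN nu k kadm.
have h0 := site_energy_ge0 v.
apply: le_trans (_ : \sum_(o : {ffun 'I_d -> 'I_(k.*2.+1)}) (hsite UV x (cube_pt nu k o) +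
    (if cube_pt nu k o == i then site_energy v else 0)) <= _).
  apply: ler_sum => o _; rewrite {1}/hsite /upd; case: eqP => _.
    rewrite -/(site_energy v) lerDr; apply: le_trans ler01 _; apply: hsite_ge1 => j q; exact: U0.
  by rewrite addr0.
rewrite big_split /= mulrDl; apply: lerD; first exact: xN.
have c1 : 1 <= (k.*2.+1)%:R ^+ d :> R by rewrite exprn_ege1 // ler1n.
apply: le_trans (_ : site_energy v <= _); last by rewrite ler_peMr.
case: (pickP (fun o : {ffun 'I_d -> 'I_(k.*2.+1)} => cube_pt nu k o == i)) => [p /eqP pi|none].
  rewrite (bigD1 p) //= pi eqxx big1 ?addr0 // => p' p'p.
  by case: eqP => // p'i; move: p'p; rewrite -(inj_eq (@cube_pt_inj d nu k)) pi p'i eqxx.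
by rewrite big1 // => o _; rewrite none.
Qed.

Lemma site_energy_near w : \forall v \near w, site_energy v <= site_energy w + 1.
Proof.
have c : {for w, continuous site_energy}.
  apply: cvgD; last exact: cvg_cst.
  apply: cvgD.
    apply: cvgM; last exact: cvg_cst.
    by apply: cvgM; exact: cvg_snd.
  apply: (@continuous_comp _ _ _ (fun v : R * R => v.1) (horner U)); first exact: cvg_fst.
  exact: continuous_horner.
have /cvgrPdist_le /(_ 1 ltr01) := c.
apply: filterS => v; rewrite ler_norml => /andP[]; lra.
Qed.

Lemma norm_fst_le (v : R * R) : `|v.1| <= `|v|.
Proof. by rewrite prod_normE le_max lexx. Qed.

Lemma norm_snd_le (v : R * R) : `|v.2| <= `|v|.
Proof. by rewrite prod_normE le_max lexx orbT. Qed.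

(** The partial derivatives are the solutions [xi1] and [xi2] of the linearised equation started
    from a unit position and a unit momentum at i. All v near w share one energy bound up to time T,
    hence one weight. *)
Lemma flow_differentiable (x : state R d) N i (y : R * R -> R -> state R d) :
  bnd UV x N ->
  (forall v, y v 0 = upd x i v) ->
  (forall v t, gsolves_at K UG (y v) t) ->
  (forall v t, exists N', bnd UV (y v t) N') ->
  forall (t : R) j (b : bool) (w : R * R), differentiable (fun v => comp (y v t) j b) w.
Proof.
move=> xN y0 ys yb t j b w.
have C11' := C11; have N1 := bnd_ge1 d0 (fun _ => U0) xN.
pose T : R := `|t|.
pose sp := speed d K (2 * C1 + 4) 1.
have sp0 : 0 <= sp by apply: speed_ge0 => //; [exact: ltW|lra].
have [N2 bN2] : exists N2, forall v s, site_energy v <= site_energy w + 1 -> `|s| <= T ->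
    gsolves_at K UG (y v) s /\ bnd UV (y v s) N2.
  exists ((N + (site_energy w + 1) + 1 ^+ 4) * expR (sp * T)) => v s hv sT.
  split; first exact: ys.
  have yN : bnd UV (y v 0) (N + (site_energy w + 1)).
    by rewrite y0; apply: bnd_mono (upd_bnd _ _ xN); rewrite lerD2l.
  apply: bnd_mono (solution_energy d0 K0 C11 U0 Uq ltr01 (ys v) (yb v) yN s).
  rewrite ler_wpM2l ?ler_expR ?ler_wpM2l // expr1n.
  by have := site_energy_ge0 w; lra.
have T0 : 0 <= T by exact: normr_ge0.
have T00 : `|0 : R| <= T by rewrite normr0.
have ww : site_energy w <= site_energy w + 1 by lra.
have N21 := bnd_ge1 d0 (fun _ => U0) (bN2 w 0 ww T00).2.
set M := C1 * (1 + 4 * C1 * (5 ^+ d * N2)).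
have f0 : 0 <= 5 ^+ d * N2 by rewrite !mulr_ge0 ?exprn_ge0 //; lra.
have Cf0 : 0 <= C1 * (5 ^+ d * N2) by rewrite mulr_ge0 //; lra.
have M0 : 0 <= M by rewrite /M mulr_ge0 //; lra.
set c := rate d K M.
have c2 : 2 <= c by have := rate_ge d (ltW K0) M0.
have cM : 2 * M <= c by apply: rate_ge_double; exact: ltW.
have c0 : 0 <= c by lra.
have sq_bd v s k : site_energy v <= site_energy w + 1 -> `|s| <= T ->
    (y v s k).1 ^+ 2 <= 2 * C1 * (5 ^+ d * N2) * ell R k.
  by move=> hv sT; have [_ h _] := quartic_ge_sqr d0 C11 U0 Uq k (bN2 v s hv sT).2.
pose g s k q := U2 (y w (clamp T s) k).1 * q : R.
have gbd s k : `|U2 (y w (clamp T s) k).1| <= M * ell R k.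
  apply: (le_trans (U2bd _)); rewrite /M -mulrA ler_wpM2l //; first lra.
  have := sq_bd w (clamp T s) k ww (clamp_bd s T0); have := ell_site_ge1 R k.
  have : 0 <= C1 * (5 ^+ d * N2) * ell R k.
    by rewrite mulr_ge0 // (le_trans _ (ell_site_ge1 R k)).
  lra.
have yc k : continuous (fun s => (y w s k).1).
  by move=> s; have [h _] := ys w s k; exact: is_derive_cont h.
have clc : continuous (clamp T).
  by apply: (@lipschitz_continuous R _ 1) => q r; rewrite mul1r; exact: clamp_lip.
have M10 : 0 <= M + 1 by lra.
have flow (e : R * R) : `|e.1| <= 1 -> `|e.2| <= 1 ->
    exists xi : R -> state R d, [/\ xi 0 = upd (fun _ => (0, 0)) i e,
      forall s, gsolves_at K (g s) xi s &
      forall s k b', `|comp (xi s) k b'| <= 3 * (M + 1) * swt 1 c k `|s|].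
  move=> e1 e2; apply: (@lattice_flow R d K (ltW K0) g M (M + 1)) => //.
  - move=> k u uc s; apply: cvgM; last exact: uc.
    apply: (@continuous_comp _ _ _ (fun s => (y w (clamp T s) k).1) U2); last exact: U2c.
    apply: (@continuous_comp _ _ _ (clamp T) (fun s => (y w s k).1)); [exact: clc|exact: yc].
  - by move=> s k q r; rewrite -mulrBr normrM ler_wpM2r.
  - move=> s k; rewrite normrM.
    have h1 : `|(upd (fun=> (0, 0)) i e k).1| <= 1 by rewrite /upd; case: eqP => //=; rewrite normr0.
    have h2 := ler_pM (normr_ge0 _) (normr_ge0 _) (gbd s k) h1.
    by have := ell_site_ge1 R k; lra.
  - move=> k b'.
    have h1 : `|comp (upd (fun=> (0, 0)) i e) k b'| <= 1.
      by rewrite /comp /upd; case: b'; case: eqP => //=; rewrite normr0.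
    by have := ell_site_ge1 R k; have := mulr_ge0 M0 (le_trans ler01 (ell_site_ge1 R k)); lra.
have n1 : `|1 : R| <= 1 by rewrite normr1.
have n0 : `|0 : R| <= 1 by rewrite normr0.
have [xi1 [xi10 xi1s xi1b]] := flow (1, 0) n1 n0.
have [xi2 [xi20 xi2s xi2b]] := flow (0, 1) n0 n1.
apply: (@differentiable_quadratic_remainder R _ w (comp (xi1 t) j b) (comp (xi2 t) j b)
  (2 * swt (2 * 1) (2 * c) j T)).
apply: filterS (site_energy_near w) => v hv.
set a1 := v.1 - w.1; set a2 := v.2 - w.2; set nv := `|v - w|.
have nv0 : 0 <= nv by exact: normr_ge0.
have a1n : `|a1| <= nv by exact: (norm_fst_le (v - w)).
have a2n : `|a2| <= nv by exact: (norm_snd_le (v - w)).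
have delta := solution_stability d0 K0 C11 U0 Uq Ulip T0 nv0
  (fun s => bN2 v s hv) (fun s => bN2 w s ww).
have {}delta s k b' : `|s| <= T ->
    `|comp (y v s) k b' - comp (y w s) k b'| <= 2 * nv * swt 1 c k `|s|.
  apply: delta => k' b''; rewrite !y0.
  apply: le_trans (_ : nv <= _); last by rewrite ler_peMr // wt_ge1.
  by rewrite /comp /upd; case: b''; case: eqP => // _; rewrite subrr normr0.
pose zeta s k := ((y v s k).1 - (y w s k).1 - (a1 * (xi1 s k).1 + a2 * (xi2 s k).1),
                  (y v s k).2 - (y w s k).2 - (a1 * (xi1 s k).2 + a2 * (xi2 s k).2)).
have compE s k b' : comp (zeta s) k b' =
    comp (y v s) k b' - comp (y w s) k b' - (comp (xi1 s) k b' * a1 + comp (xi2 s) k b' * a2).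
  by case: b'; rewrite /comp /zeta /=; ring.
rewrite -compE (_ : 2 * _ * nv ^+ 2 = 2 * nv ^+ 2 * swt (2 * 1) (2 * c) j T); last by ring.
have coupE s k : coupling (zeta s) k = coupling (y v s) k - coupling (y w s) k
    - (a1 * coupling (xi1 s) k + a2 * coupling (xi2 s) k).
  rewrite /coupling -sumrB !mulr_sumr -big_split /= -sumrB; apply: eq_bigr => o _.
  by case: ifP => _; ring.
have sq_le (k : site d) (s : R) : `|s| <= T -> swt 1 c k `|s| ^+ 2 <= swt (2 * 1) (2 * c) k `|s|.
  by move=> _; exact: wt_sq.
apply: (@lattice_stability R d K (ltW K0) M T (nv ^+ 2) (2 * nv + 6 * (M + 1) * nv) (2 * 1) (2 * c) zeta
  (fun s k => U^`().[(y v s k).1] - U^`().[(y w s k).1] -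
     U2 (y w s k).1 * (a1 * (xi1 s k).1 + a2 * (xi2 s k).1))) => //.
- exact: sqr_ge0.
- by rewrite addr_ge0 // ?mulr_ge0.
- by rewrite mulr1 ler1n.
- by rewrite -/c; lra.
- move=> s k sT; have [h1 h2] := ys v s k; have [h3 h4] := ys w s k.
  have [h5 h6] := xi1s s k; have [h7 h8] := xi2s s k; split.
    exact: pderB (pderB h1 h3) (pderD (pderZ a1 h5) (pderZ a2 h7)).
  apply: (pder_eq (pderB (pderB h2 h4) (pderD (pderZ a1 h6) (pderZ a2 h8)))).
  by rewrite coupE /UG /onsite_force /g (clamp_id sT); ring.
- move=> s k sT.
  set q := (y v s k).1; set r := (y w s k).1.
  set X := a1 * _ + _.
  have -> : U^`().[q] - U^`().[r] - U2 r * X =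
    (U^`().[q] - U^`().[r] - U2 r * (q - r)) + U2 r * (zeta s k).1.
    by rewrite /zeta /= -/q -/r -/X; ring.
  rewrite addrC; apply: (le_trans (ler_normD _ _)); apply: lerD.
    by rewrite normrM ler_wpM2r //; have := gbd s k; rewrite (clamp_id sT).
  apply: (le_trans (Utaylor q r)).
  have hq := sq_bd v s k hv sT; have hr := sq_bd w s k ww sT; have l1 := ell_site_ge1 R k.
  have k1 : C1 * (1 + q ^+ 2 + r ^+ 2) <= M * ell R k.
    rewrite /M -mulrA ler_wpM2l //; first lra.
    by move: hq hr; rewrite -/q -/r; lra.
  have k2 : (q - r) ^+ 2 <= 4 * nv ^+ 2 * swt (2 * 1) (2 * c) k `|s|.
    have h := delta s k false sT; rewrite /comp -/q -/r in h.
    rewrite -(real_normK (num_real (q - r))).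
    apply: le_trans (_ : (2 * nv * swt 1 c k `|s|) ^+ 2 <= _).
      by rewrite lerXn2r // nnegrE // !mulr_ge0 // wt_ge0.
    rewrite exprMn (_ : (2 * nv) ^+ 2 = 4 * nv ^+ 2); last by ring.
    by apply: ler_wpM2l; [rewrite mulr_ge0 // sqr_ge0|exact: sq_le].
  have k0 : 0 <= C1 * (1 + q ^+ 2 + r ^+ 2).
    by rewrite mulr_ge0 //; [lra|rewrite !addr_ge0 // sqr_ge0].
  apply: (le_trans (ler_pM k0 (sqr_ge0 _) k1 k2)).
  (* Squaring 2 nv gives a factor 4, and the doubled rate 2c is at least 4M, so the Taylor error
     fits into nv^2 times the derivative of the doubled weight. *)
  have a21 : 1 <= 2 * 1 :> R by rewrite mulr1 ler1n.
  have c20 : 0 <= 2 * c by rewrite mulr_ge0.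
  have [_ _ _ dw] := swt_bounds k a21 c20 (normr_ge0 s).
  apply: le_trans (ler_wpM2l (sqr_ge0 nv) dw).
  have -> : M * ell R k * (4 * nv ^+ 2 * swt (2 * 1) (2 * c) k `|s|) =
     nv ^+ 2 * (2 * (2 * M) * ell R k * swt (2 * 1) (2 * c) k `|s|) by ring.
  apply: ler_wpM2l; first exact: sqr_ge0.
  apply: ler_wpM2r; first exact: wt_ge0.
  by apply: ler_wpM2r; [exact: le_trans l1|rewrite ler_wpM2l].
- move=> k b'; rewrite compE !y0 xi10 xi20.
  have -> : comp (upd x i v) k b' - comp (upd x i w) k b' -
    (comp (upd (fun=> (0, 0)) i (1, 0)) k b' * a1 + comp (upd (fun=> (0, 0)) i (0, 1)) k b' * a2) = 0.
    by rewrite /comp /upd /a1 /a2; case: b'; case: eqP => _ /=; ring.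
  by rewrite normr0 mulr_ge0 ?sqr_ge0 // wt_ge0.
- move=> s k b' sT; rewrite compE.
  have w1 : 1 <= swt 1 c k `|s| by exact: wt_ge1.
  have h1 := delta s k b' sT.
  have h2 : `|comp (xi1 s) k b' * a1| <= 3 * (M + 1) * swt 1 c k `|s| * nv.
    by rewrite normrM; apply: ler_pM.
  have h3 : `|comp (xi2 s) k b' * a2| <= 3 * (M + 1) * swt 1 c k `|s| * nv.
    by rewrite normrM; apply: ler_pM.
  have w2 : swt 1 c k `|s| <= swt (2 * 1) (2 * c) k `|s|.
    by apply: (le_trans _ (sq_le k s sT)); exact: ler_eXnr.
  have B0 : 0 <= 2 * nv + 6 * (M + 1) * nv by rewrite addr_ge0 // ?mulr_ge0.
  apply: le_trans (ler_wpM2l B0 w2).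
  apply: (le_trans (ler_normB _ _)).
  by have := ler_normD (comp (xi1 s) k b' * a1) (comp (xi2 s) k b' * a2); lra.
Qed.

End FlowDifferentiability.

(** * The flow *)

Unset Implicit Arguments.
Theorem theorem2p1 (R : realType) (d : nat) (U : {poly R}) (K : R)
  (hd : (0 < d)%N) (hK : 0 < K)
  (hUsize : size U = 5%N) (hUlead : 0 < lead_coef U)
  (hUnonneg : forall r : R, 0 <= U.[r]) :
  exists (Phi : R -> state R d -> state R d) (C0 : R),
    (forall x, X0 U K x -> forall t, X0 U K (Phi t x)) /\
    (forall x, X0 U K x -> Phi 0 x = x) /\
    (forall x, X0 U K x -> forall s t, Phi (s + t) x = Phi s (Phi t x)) /\
    (forall x, X0 U K x -> solves U K (fun t => Phi t x)) /\
    (forall x, X0 U K x -> forall y : R -> state R d,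
        (forall t, X0 U K (y t)) -> y 0 = x -> solves U K y ->
        forall t, y t = Phi t x) /\
    (forall x, X0 U K x -> forall (t : R) (i j : site d) (w : R * R),
        differentiable (fun v : R * R => Phi t (upd x i v) j) w) /\
    (forall x, X0 U K x -> forall t : R,
        (Qfun U K (Phi t x) <=
         (C0 * (fine (Qfun U K x) * ln (expR 1 + fine (Qfun U K x)) + t ^+ 4))%:E)%E).
Proof.
have [C1 [U2 [C11 Uq Ulip Utaylor [U2bd U2c Uout]]]] := quartic_bounds hUsize hUlead hUnonneg.
have X0P := fun x : state R d => X0_bnd hK C11 hUnonneg Uq x.
(* Outside X_0 the constant path is a dummy that makes the choice total. *)
have sol (x : state R d) : exists y : R -> state R d, X0 U K x ->
    [/\ y 0 = x, forall t, gsolves_at K (onsite_force U) y t & forall t, X0 U K (y t)].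
  have [/X0P[N xN]|nX] := pselect (X0 U K x); last by exists (fun _ => x).
  have [y [y0 ys yb]] := global_solution hd hK C11 hUnonneg Uq Ulip Uout xN.
  by exists y => _; split => // t; apply/X0P; exact: yb.
have [F FP] := choice sol.
pose Phi t x := F x t.
have PhiX x : X0 U K x -> forall t, X0 U K (Phi t x) by move=> /FP[].
have Phi0 x : X0 U K x -> Phi 0 x = x by move=> /FP[].
have Phis x : X0 U K x -> forall t, gsolves_at K (onsite_force U) (fun s => Phi s x) t by move=> /FP[].
have Phiu x : X0 U K x -> forall y : R -> state R d,
    (forall t, X0 U K (y t)) -> y 0 = x -> (forall t, gsolves_at K (onsite_force U) y t) ->
    forall t, y t = Phi t x.
  move=> xX y yX y0 ys; apply: (solution_unique hd hK C11 hUnonneg Uq Ulip ys) => [t||t|].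
  - by apply/X0P; exact: yX.
  - exact: Phis.
  - by apply/X0P; exact: PhiX.
  - by rewrite y0 Phi0.
pose S := K * 27 ^+ d * (4 + (2 * C1 + 4)).
pose C0 := cW d K C1 * expR S.
have cW0 : 0 <= cW d K C1.
  by rewrite addr_ge0 // !mulr_ge0 ?exprn_ge0 ?(ltW hK) // (le_trans _ C11).
exists Phi, C0; split=> //; split=> //; split; [|split; [|split; [|split]]].
- move=> x xX s t.
  have PtX := PhiX x xX t.
  apply: (Phiu _ PtX (fun s => Phi (s + t) x)) => [r||r i].
  + exact: PhiX.
  + by rewrite add0r.
  + have [h1 h2] := Phis x xX (r + t) i.
    have shift (f : R -> R) df : is_derive (r + t) 1 f df -> is_derive r 1 (fun u => f (u + t)) df.
      move=> fd; have := @pder_comp R r f (fun u => u + t) _ _ fd (pderD (pder_id r) (pderC r t)).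
      by rewrite addr0 mulr1.
    by split; [exact: (shift _ _ h1)|exact: (shift _ _ h2)].
- by move=> x xX i t; exact: Phis.
- by move=> x xX y yX y0 ys; apply: Phiu => // t i; exact: ys.
- move=> x /X0P[N xN] t i j w.
  have uX v : X0 U K (upd x i v) by apply/X0P; eexists; exact: (upd_bnd hUnonneg i v xN).
  have D b : differentiable (fun v => comp (Phi t (upd x i v)) j b) w.
    apply: (flow_differentiable hd hK C11 hUnonneg Uq Ulip Utaylor U2bd U2c
      (y := fun v s => Phi s (upd x i v)) xN) => [v|v s|v s].
    - exact: Phi0.
    - exact: Phis.
    - by apply/X0P; exact: PhiX.
  rewrite (_ : (fun v => _) = (fun v => (comp (Phi t (upd x i v)) j false, comp (Phi t (upd x i v)) j true))).
    exact: differentiable_pair.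
  by apply/funext => v; rewrite /comp; case: (Phi _ _ _).
- move=> x xX t.
  have [QE Q1] := X0_Qfun hd hK hUnonneg xX.
  set Q := fine _ in QE Q1 *.
  have lnQ : 1 <= ln (expR 1 + Q) by apply: ell_ge1; lra.
  have t4 : 0 <= t ^+ 4 by rewrite exprn_even_ge0.
  have QlnQ : Q <= Q * ln (expR 1 + Q) by rewrite ler_peMr //; lra.
  have eS : 0 <= expR S by exact: expR_ge0.
  have xQ : bnd (onsite U) x Q by apply: (bnd_Qfun hK); rewrite QE lexx.
  have bt : bnd (onsite U) (Phi t x) (expR S * (Q + t ^+ 4)).
    (* The choice lam = |t| turns the exponent [speed * |t|] into the constant [S] but needs t != 0;
       at t = 0 the bound is trivial since e^S >= 1. *)
    have [->|tn0] := eqVneq t 0.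
      rewrite Phi0 //; apply: bnd_mono xQ; rewrite expr0n addr0.
      rewrite ler_peMl //; first lra.
      rewrite -expR0 ler_expR !mulr_ge0 ?exprn_ge0 ?(ltW hK) //; lra.
    have tp : 0 < `|t| by rewrite normr_gt0.
    have h := solution_energy hd hK C11 hUnonneg Uq tp (Phis x xX) (fun s => (X0P _).1 (PhiX x xX s)) _ t.
    have {h} := h Q; rewrite Phi0 // => /(_ xQ).
    rewrite -normrX (ger0_norm t4) /speed divfK ?gt_eqF // -/S mulrC //.
  apply: (le_trans (Qfun_le hK C11 hUnonneg Uq bt)).
  rewrite lee_fin /C0 -mulrA ler_wpM2l // ler_wpM2l //; lra.
Qed.
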